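(* Let $R$ be a Noetherian ring, let $\varphi\colon R\to A$ be a Frobenius extension, and let $n>0$. Assume the Krull–Remak–Schmidt theorem (KRS) holds for finitely generated left $R$-modules and for finitely generated left $A$-modules. Then: (1) Assume $\varphi$ is separable. If $\mathrm{TF}^n(R)$ has finite representation type, then so does $\mathrm{TF}^n(A)$. (2) Assume $\varphi$ is split. If $\mathrm{TF}^n(A)$ has finite representation type, then so does $\mathrm{TF}^n(R)$.
   Context: A ring is Noetherian if it is left and right Noetherian. Modules are left modules unless stated otherwise; $R^{\mathrm{op}}$-modules are right $R$-modules. A ring homomorphism $R\to A$ is a Frobenius extension if $A$ is a finitely generated projective left $R$-module and $A\cong\operatorname{Hom}_R(A,R)$ as $A$-$R$-bimodules. It is separable if the multiplication map $A\otimes_RA\to A$, $a\otimes b\mapsto ab$, is a split epimorphism of $A$-$A$-bimodules. It is split if $A\cong R\oplus M$ as $R$-$R$-bimodules for some $R$-$R$-bimodule $M$. KRS for finitely generated left $R$-modules: every finitely generated left $R$-module is a finite direct sum of indecomposable modules, uniquely up to isomorphism and reordering of the summands. For a finitely generated left $R$-module $M$ and an exact sequence $P_1\xrightarrow{f}P_0\to M\to 0$ with $P_0,P_1$ finitely generated projective, $\operatorname{Tr}_R(M)=\operatorname{coker}(\operatorname{Hom}_R(f,R))$ (a right $R$-module, independent of choices up to projective summands). For $n>0$, $M$ is $n$-torsionfree if $\operatorname{Ext}^i_{R^{\mathrm{op}}}(\operatorname{Tr}_R(M),R)=0$ for all $1\le i\le n$. $\mathrm{TF}^n(R)$ is the full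 subcategory of the category of finitely generated left $R$-modules consisting of the $n$-torsionfree modules; similarly for $A$. A full subcategory of finitely generated modules has finite representation type if it contains only finitely many isomorphism classes of indecomposable modules. *)

(* Defs.v *)
From HB Require Import structures.
From mathcomp Require Import all_boot all_algebra.
From mathcomp Require Import boolp.
Set Implicit Arguments.
Unset Strict Implicit.
Unset Printing Implicit Defensive.
Import GRing.Theory.
Local Open Scope ring_scope.
Local Open Scope quotient_scope.

(* A right R-module is an lmodType over the converse ring R^c; in particular  *)
(* (R^c)^o is R as a right module over itself.  Rings are pzRingTypes: the    *)
(* zero ring is allowed.                                                      *)

Section Modules.
Variable R : pzRingType.
Implicit Types M N L : lmodType R.

Definition lmod_iso M N : Prop := exists f : {linear M -> N}, bijective f.

Definition trivial_module M : Prop := forall x : M, x = 0.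

Definition finitely_generated M : Prop :=
  exists n (v : 'I_n -> M), forall x, exists c : 'I_n -> R,
    x = \sum_(i < n) c i *: v i.

Definition projective (P : lmodType R) : Prop :=
  forall M N (p : {linear M -> N}) (g : {linear P -> N}),
    (forall y, exists x, p x = y) ->
    exists h : {linear P -> M}, forall x, p (h x) = g x.

Definition indecomposable M : Prop :=
  ~ trivial_module M /\
  forall X Y : lmodType R, lmod_iso M (X * Y)%type ->
    trivial_module X \/ trivial_module Y.

Definition exact_at M N L (f : {linear M -> N}) (g : {linear N -> L}) : Prop :=
  forall y, g y = 0 <-> exists x, f x = y.

Definition left_noetherian : Prop :=
  forall I : {pred R^o}, GRing.submod_closed I ->
    exists n (v : 'I_n -> R^o), (forall i, v i \in I) /\
      forall x, x \in I -> exists c : 'I_n -> R, x = \sum_(i < n) c i *: v i.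

(* Full subcategories are given by predicates on modules. *)
Definition finite_rep_type (C : lmodType R -> Prop) : Prop :=
  exists n (X : 'I_n -> lmodType R),
    forall M, C M -> indecomposable M -> exists i, lmod_iso M (X i).

End Modules.

Definition noetherian (R : pzRingType) : Prop :=
  left_noetherian R /\ left_noetherian R^c.

Definition dsum (R : pzRingType) n (X : 'I_n -> lmodType R) : Type :=
  forall i, X i.

Section DirectSum.
Variables (R : pzRingType) (n : nat) (X : 'I_n -> lmodType R).
Implicit Types u v w : dsum X.

HB.instance Definition _ := Choice.copy (dsum X) (forall i, X i).

Definition dsum0 : dsum X := fun=> 0.
Definition dsum_opp u : dsum X := fun i => - u i.
Definition dsum_add u v : dsum X := fun i => u i + v i.
Definition dsum_scale (r : R) u : dsum X := fun i => r *: u i.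

Let dsum_addA : associative dsum_add.
Proof. by move=> u v w; apply/functional_extensionality_dep=> i; exact: addrA. Qed.
Let dsum_addC : commutative dsum_add.
Proof. by move=> u v; apply/functional_extensionality_dep=> i; exact: addrC. Qed.
Let dsum_add0 : left_id dsum0 dsum_add.
Proof. by move=> u; apply/functional_extensionality_dep=> i; exact: add0r. Qed.
Let dsum_addN : left_inverse dsum0 dsum_opp dsum_add.
Proof. by move=> u; apply/functional_extensionality_dep=> i; exact: addNr. Qed.

HB.instance Definition _ :=
  GRing.isZmodule.Build (dsum X) dsum_addA dsum_addC dsum_add0 dsum_addN.

Let dsum_scaleA r s u : dsum_scale r (dsum_scale s u) = dsum_scale (r * s) u.
Proof. by apply/functional_extensionality_dep=> i; exact: scalerA. Qed.
Let dsum_scale1 : left_id 1 dsum_scale.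
Proof. by move=> u; apply/functional_extensionality_dep=> i; exact: scale1r. Qed.
Let dsum_scaleDr : right_distributive dsum_scale +%R.
Proof. by move=> r u v; apply/functional_extensionality_dep=> i; exact: scalerDr. Qed.
Let dsum_scaleDl u : {morph dsum_scale^~ u : r s / r + s}.
Proof. by move=> r s; apply/functional_extensionality_dep=> i; exact: scalerDl. Qed.

HB.instance Definition _ := GRing.Zmodule_isLmodule.Build R (dsum X)
  dsum_scaleA dsum_scale1 dsum_scaleDr dsum_scaleDl.

End DirectSum.

Definition KRS (R : pzRingType) : Prop :=
  forall M : lmodType R, finitely_generated M ->
    (exists n (X : 'I_n -> lmodType R),
        (forall i, indecomposable (X i)) /\ lmod_iso M (dsum X)) /\
    (forall m n (X : 'I_m -> lmodType R) (Y : 'I_n -> lmodType R),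
        (forall i, indecomposable (X i)) -> (forall j, indecomposable (Y j)) ->
        lmod_iso M (dsum X) -> lmod_iso M (dsum Y) ->
        exists s : 'I_m -> 'I_n,
          bijective s /\ forall i, lmod_iso (X i) (Y (s i))).

Definition hom (R : pzRingType) (M N : lmodType R) : Type := {linear M -> N}.

Section Hom.
Variables (R : pzRingType) (M N : lmodType R).
Implicit Types f g h : hom M N.

HB.instance Definition _ := gen_eqMixin (hom M N).
HB.instance Definition _ := gen_choiceMixin (hom M N).

Lemma hom_ext f g : (forall x, f x = g x) -> f = g.
Proof.
case: f g => [f [[af] [zf]]] [g [[ag] [zg]]] /= /funext fg; subst g.
by rewrite (Prop_irrelevance af ag) (Prop_irrelevance zf zg).
Qed.

Let add_fun_linear f g : linear (fun x => f x + g x).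
Proof. by move=> r x y; rewrite !linearP scalerDr addrACA. Qed.
Let opp_fun_linear f : linear (fun x => - f x).
Proof. by move=> r x y; rewrite linearP opprD scalerN. Qed.
Let null_fun_linear : linear (fun _ : M => 0 : N).
Proof. by move=> r x y; rewrite scaler0 addr0. Qed.

Definition hom0 : hom M N :=
  HB.pack (fun _ : M => 0 : N) (GRing.isLinear.Build R M N *:%R _ null_fun_linear).
Definition hom_add f g : hom M N :=
  HB.pack (fun x => f x + g x)
    (GRing.isLinear.Build R M N *:%R _ (add_fun_linear f g)).
Definition hom_opp f : hom M N :=
  HB.pack (fun x => - f x) (GRing.isLinear.Build R M N *:%R _ (opp_fun_linear f)).

Let hom_addA : associative hom_add.
Proof. by move=> f g h; apply: hom_ext => x; exact: addrA. Qed.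
Let hom_addC : commutative hom_add.
Proof. by move=> f g; apply: hom_ext => x; exact: addrC. Qed.
Let hom_add0 : left_id hom0 hom_add.
Proof. by move=> f; apply: hom_ext => x; exact: add0r. Qed.
Let hom_addN : left_inverse hom0 hom_opp hom_add.
Proof. by move=> f; apply: hom_ext => x; exact: addNr. Qed.

HB.instance Definition _ :=
  GRing.isZmodule.Build (hom M N) hom_addA hom_addC hom_add0 hom_addN.

End Hom.

(* The right R-module Hom_R(M, R), with (f r)(x) = f(x) r.                    *)
Definition dual (R : pzRingType) (M : lmodType R) : Type := hom M R^o.

Section Dual.
Variables (R : pzRingType) (M : lmodType R).
Implicit Types f g : dual M.

HB.instance Definition _ := GRing.Zmodule.copy (dual M) (hom M R^o).

Let mulr_fun_linear (r : R) f : linear (fun x => f x * r : R^o).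
Proof. by move=> s x y; rewrite linearP mulrDl; congr (_ + _); exact/esym/mulrA. Qed.

Definition dual_scale (r : R^c) f : dual M :=
  HB.pack (fun x => f x * (r : R) : R^o)
    (GRing.isLinear.Build R M R^o *:%R _ (mulr_fun_linear r f)).

Let dual_scaleA r s f : dual_scale r (dual_scale s f) = dual_scale (r * s) f.
Proof. by apply: hom_ext => x /=; rewrite -mulrA. Qed.
Let dual_scale1 : left_id 1 dual_scale.
Proof. by move=> f; apply: hom_ext => x; exact: mulr1. Qed.
Let dual_scaleDr : right_distributive dual_scale +%R.
Proof. by move=> r f g; apply: hom_ext => x; exact: mulrDl. Qed.
Let dual_scaleDl f : {morph dual_scale^~ f : r s / r + s}.
Proof. by move=> r s; apply: hom_ext => x; exact: mulrDr. Qed.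

HB.instance Definition _ := GRing.Zmodule_isLmodule.Build R^c (dual M)
  dual_scaleA dual_scale1 dual_scaleDr dual_scaleDl.

End Dual.

Section DualMap.
Variables (R : pzRingType) (M N : lmodType R) (f : {linear M -> N}).

Definition dual_map (g : dual N) : dual M := (g : {linear N -> R^o}) \o f.

Let dual_map_linear : linear dual_map.
Proof. by move=> r g h; apply: hom_ext => x. Qed.

HB.instance Definition _ :=
  GRing.isLinear.Build R^c (dual N) (dual M) *:%R dual_map dual_map_linear.

End DualMap.

Section Cokernel.
Variables (R : pzRingType) (M N : lmodType R) (f : {linear M -> N}).

Definition img : {pred N} := fun y => `[< exists x, f x = y >].

Let img_zmod_closed : zmod_closed img.
Proof.
split=> [|_ _ /asboolP[x <-] /asboolP[y <-]]; apply/asboolP.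
  by exists 0; rewrite linear0.
by exists (x - y); rewrite linearB.
Qed.
HB.instance Definition _ := GRing.isZmodClosed.Build N img img_zmod_closed.

Definition coker : Type := Quotient.quot img.

HB.instance Definition _ := GRing.Zmodule.copy coker (Quotient.quot img).

Definition coker_pi (y : N) : coker := \pi_(Quotient.quot img) y.
Definition coker_scale (r : R) (u : coker) : coker :=
  coker_pi (r *: repr (u : Quotient.quot img)).

Lemma coker_pi_eq y z : (coker_pi y = coker_pi z) <-> exists x, f x = y - z.
Proof.
split=> [/eqP|h].
  by rewrite /coker_pi -Quotient.idealrBE => /asboolP.
by apply/eqP; rewrite /coker_pi -Quotient.idealrBE; apply/asboolP.
Qed.

Lemma coker_piD : {morph coker_pi : y z / y + z}.
Proof. by move=> y z; rewrite /coker_pi raddfD. Qed.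

Lemma coker_piZ r y : coker_pi (r *: y) = coker_scale r (coker_pi y).
Proof.
apply/coker_pi_eq.
have /coker_pi_eq[x fx] :
    coker_pi y = coker_pi (repr (coker_pi y : Quotient.quot img)).
  by rewrite {2}/coker_pi reprK.
by exists (r *: x); rewrite linearZ /= fx scalerBr.
Qed.

Lemma coker_ind (P : coker -> Prop) :
  (forall y, P (coker_pi y)) -> forall u, P u.
Proof. by move=> Ppi; elim/quotW. Qed.

Let coker_scaleA r s u : coker_scale r (coker_scale s u) = coker_scale (r * s) u.
Proof. by elim/coker_ind: u => y; rewrite -!coker_piZ scalerA. Qed.
Let coker_scale1 : left_id 1 coker_scale.
Proof. by elim/coker_ind=> y; rewrite -coker_piZ scale1r. Qed.
Let coker_scaleDr : right_distributive coker_scale +%R.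
Proof.
move=> r; elim/coker_ind=> y; elim/coker_ind=> z.
by rewrite -!coker_piZ -!coker_piD -coker_piZ scalerDr.
Qed.
Let coker_scaleDl u : {morph coker_scale^~ u : r s / r + s}.
Proof. by elim/coker_ind: u => y r s; rewrite -!coker_piZ -coker_piD scalerDl. Qed.

HB.instance Definition _ := GRing.Zmodule_isLmodule.Build R coker
  coker_scaleA coker_scale1 coker_scaleDr coker_scaleDl.

End Cokernel.

Record proj_resolution (R : pzRingType) (N : lmodType R) := ProjResolution {
  res_module :> nat -> lmodType R;
  res_d : forall i, {linear res_module i.+1 -> res_module i};
  res_aug : {linear res_module 0%N -> N};
  res_projective : forall i, projective (res_module i);
  res_aug_surj : forall y, exists x, res_aug x = y;
  res_exact0 : exact_at (res_d 0) res_aug;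
  res_exact : forall i, exact_at (res_d i.+1) (res_d i)
}.

(* Every i-cocycle of the complex Hom(P, L) is a coboundary.                  *)
Definition hom_acyclic_at (R : pzRingType) (N L : lmodType R)
    (P : proj_resolution N) (i : nat) : Prop :=
  match i with
  | 0 => forall f : {linear P 0%N -> L},
           (forall x, f (res_d P 0 x) = 0) -> forall x, f x = 0
  | j.+1 => forall f : {linear P j.+1 -> L},
           (forall x, f (res_d P j.+1 x) = 0) ->
           exists g : {linear P j -> L}, forall x, f x = g (res_d P j x)
  end.

(* Ext does not depend on the resolution computing it, and projective         *)
(* resolutions always exist, so "some" here is the same as "every".            *)
Definition Ext_vanishes (R : pzRingType) (i : nat) (N L : lmodType R) : Prop :=
  exists P : proj_resolution N, hom_acyclic_at L P i.

(* P1 --f--> P0 --p--> M --> 0 is the presentation computing Tr M, which is   *)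
(* coker (dual_map f), a right module.  Tr M is unique up to projective       *)
(* summands, on which Ext^i vanishes for i > 0, so any presentation may be    *)
(* used in the definition of torsionfree.                                     *)
Definition fg_proj_presentation (R : pzRingType) (M P1 P0 : lmodType R)
    (f : {linear P1 -> P0}) (p : {linear P0 -> M}) : Prop :=
  [/\ finitely_generated P1 /\ projective P1,
      finitely_generated P0 /\ projective P0,
      forall y, exists x, p x = y
    & exact_at f p].

Definition torsionfree (R : pzRingType) (n : nat) (M : lmodType R) : Prop :=
  exists (P1 P0 : lmodType R) (f : {linear P1 -> P0}) (p : {linear P0 -> M}),
    fg_proj_presentation f p /\
    forall i, (1 <= i <= n)%N ->
      Ext_vanishes i (coker (dual_map f)) (R^c)^o.

Definition TF (R : pzRingType) (n : nat) (M : lmodType R) : Prop :=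
  finitely_generated M /\ torsionfree n M.

Record bimodule (R S : pzRingType) := Bimodule {
  bimod_lmod :> lmodType R;
  ract : bimod_lmod -> S -> bimod_lmod;
  ract1 : forall m, ract m 1 = m;
  ractM : forall m s t, ract m (s * t) = ract (ract m s) t;
  ractDl : forall m m' s, ract (m + m') s = ract m s + ract m' s;
  ractDr : forall m s t, ract m (s + t) = ract m s + ract m t;
  ractZ : forall r m s, ract (r *: m) s = r *: ract m s
}.

Definition bimod_hom (R S : pzRingType) (M N : bimodule R S)
    (f : {linear M -> N}) : Prop :=
  forall m s, f (ract m s) = ract (f m) s.

Definition bimod_iso (R S : pzRingType) (M N : bimodule R S) : Prop :=
  exists f : {linear M -> N}, bimod_hom f /\ bijective f.

Section RegularBimodule.
Variable A : pzRingType.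

Let reg_ractZ (r m s : A) : r * m * s = r * (m * s).
Proof. exact/esym/mulrA. Qed.

Definition reg_bimod : bimodule A A :=
  @Bimodule A A A^o (fun m s => m * s : A^o) (@mulr1 A) (@mulrA A)
    (@mulrDl A) (@mulrDr A) reg_ractZ.

End RegularBimodule.

Section SumBimodule.
Variables (R S : pzRingType) (M N : bimodule R S).

Definition sum_ract (u : M * N) (s : S) : M * N := (ract u.1 s, ract u.2 s).

Let sum_ract1 u : sum_ract u 1 = u.
Proof. by case: u => x y; rewrite /sum_ract !ract1. Qed.
Let sum_ractM u s t : sum_ract u (s * t) = sum_ract (sum_ract u s) t.
Proof. by rewrite /sum_ract !ractM. Qed.
Let sum_ractDl u v s : sum_ract (u + v) s = sum_ract u s + sum_ract v s.
Proof. by rewrite /sum_ract !ractDl. Qed.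
Let sum_ractDr u s t : sum_ract u (s + t) = sum_ract u s + sum_ract u t.
Proof. by rewrite /sum_ract !ractDr. Qed.
Let sum_ractZ r u s : sum_ract (r *: u) s = r *: sum_ract u s.
Proof. by rewrite /sum_ract !ractZ. Qed.

Definition sum_bimod : bimodule R S :=
  @Bimodule R S (M * N)%type sum_ract sum_ract1 sum_ractM sum_ractDl sum_ractDr
    sum_ractZ.

End SumBimodule.

Definition restr (R A : pzRingType) (phi : {rmorphism R -> A}) (M : lmodType A)
  : Type := M.

Section Restriction.
Variables (R A : pzRingType) (phi : {rmorphism R -> A}) (M : lmodType A).

HB.instance Definition _ := GRing.Zmodule.copy (restr phi M) M.

Definition restr_scale (r : R) (x : restr phi M) : restr phi M :=
  phi r *: (x : M).

Let restr_scaleA r s x : restr_scale r (restr_scale s x) = restr_scale (r * s) x.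
Proof. by rewrite /restr_scale rmorphM scalerA. Qed.
Let restr_scale1 : left_id 1 restr_scale.
Proof. by move=> x; rewrite /restr_scale rmorph1 scale1r. Qed.
Let restr_scaleDr : right_distributive restr_scale +%R.
Proof. by move=> r x y; exact: scalerDr. Qed.
Let restr_scaleDl x : {morph restr_scale^~ x : r s / r + s}.
Proof. by move=> r s; rewrite /restr_scale rmorphD; exact: scalerDl. Qed.

HB.instance Definition _ := GRing.Zmodule_isLmodule.Build R (restr phi M)
  restr_scaleA restr_scale1 restr_scaleDr restr_scaleDl.

End Restriction.

Section BimoduleRestriction.
Variables (R A S : pzRingType) (phi : {rmorphism R -> A}).

Definition lrestr_bimod (M : bimodule A S) : bimodule R S :=
  @Bimodule R S (restr phi M) (@ract _ _ M) (@ract1 _ _ M) (@ractM _ _ M)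
    (@ractDl _ _ M) (@ractDr _ _ M) (fun r => @ractZ _ _ M (phi r)).

Variable M : bimodule S A.

Let rrestr_ract (m : M) (r : R) : M := ract m (phi r).
Let rrestr_ract1 m : rrestr_ract m 1 = m.
Proof. by rewrite /rrestr_ract rmorph1 ract1. Qed.
Let rrestr_ractM m r s : rrestr_ract m (r * s) = rrestr_ract (rrestr_ract m r) s.
Proof. by rewrite /rrestr_ract rmorphM ractM. Qed.
Let rrestr_ractDr m r s : rrestr_ract m (r + s) = rrestr_ract m r + rrestr_ract m s.
Proof. by rewrite /rrestr_ract rmorphD ractDr. Qed.

Definition rrestr_bimod : bimodule S R :=
  @Bimodule S R M rrestr_ract rrestr_ract1 rrestr_ractM
    (fun m m' r => ractDl m m' (phi r)) rrestr_ractDr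
    (fun s m r => ractZ s m (phi r)).

End BimoduleRestriction.

(* Hom_R(M, N) is an S-T-bimodule for an R-S-bimodule M and an R-T-bimodule   *)
(* N, with (s f)(x) = f(x s) and (f t)(x) = f(x) t.                           *)

Definition bihom (R S T : pzRingType) (M : bimodule R S) (N : bimodule R T)
  : Type := hom M N.

Section HomBimodule.
Variables (R S T : pzRingType) (M : bimodule R S) (N : bimodule R T).
Implicit Types f g : bihom M N.

HB.instance Definition _ := GRing.Zmodule.copy (bihom M N) (hom M N).

Let lact_fun_linear (s : S) f : linear (fun x => f (ract x s)).
Proof. by move=> r x y; rewrite ractDl ractZ linearP. Qed.
Let ract_fun_linear f (t : T) : linear (fun x => ract (f x) t).
Proof. by move=> r x y; rewrite linearP ractDl ractZ. Qed.

Definition bihom_scale (s : S) f : bihom M N :=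
  HB.pack (fun x => f (ract x s))
    (GRing.isLinear.Build R M N *:%R _ (lact_fun_linear s f)).
Definition bihom_ract f (t : T) : bihom M N :=
  HB.pack (fun x => ract (f x) t)
    (GRing.isLinear.Build R M N *:%R _ (ract_fun_linear f t)).

Let bihom_scaleA s t f : bihom_scale s (bihom_scale t f) = bihom_scale (s * t) f.
Proof. by apply: hom_ext => x /=; rewrite ractM. Qed.
Let bihom_scale1 : left_id 1 bihom_scale.
Proof. by move=> f; apply: hom_ext => x /=; rewrite ract1. Qed.
Let bihom_scaleDr : right_distributive bihom_scale +%R.
Proof. by move=> s f g; apply: hom_ext. Qed.
Let bihom_scaleDl f : {morph bihom_scale^~ f : s t / s + t}.
Proof. by move=> s t; apply: hom_ext => x /=; rewrite ractDr linearD. Qed.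

HB.instance Definition _ := GRing.Zmodule_isLmodule.Build S (bihom M N)
  bihom_scaleA bihom_scale1 bihom_scaleDr bihom_scaleDl.

Let bihom_ract1 f : bihom_ract f 1 = f.
Proof. by apply: hom_ext => x /=; rewrite ract1. Qed.
Let bihom_ractM f s t : bihom_ract f (s * t) = bihom_ract (bihom_ract f s) t.
Proof. by apply: hom_ext => x /=; rewrite ractM. Qed.
Let bihom_ractDl f g t : bihom_ract (f + g) t = bihom_ract f t + bihom_ract g t.
Proof. by apply: hom_ext => x; exact: ractDl. Qed.
Let bihom_ractDr f s t : bihom_ract f (s + t) = bihom_ract f s + bihom_ract f t.
Proof. by apply: hom_ext => x; exact: ractDr. Qed.
Let bihom_ractZ s f t : bihom_ract (s *: f) t = s *: bihom_ract f t.
Proof. by apply: hom_ext. Qed.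

Definition hom_bimod : bimodule S T :=
  @Bimodule S T (bihom M N) bihom_ract bihom_ract1 bihom_ractM bihom_ractDl
    bihom_ractDr bihom_ractZ.

End HomBimodule.

(* M (x)_R N is the quotient of the free commutative monoid on M * N (finite  *)
(* sequences, read as sums of pure tensors) by the congruence generated by    *)
(* the tensor relations.  In the quotient, x (x) (- y) is an opposite of      *)
(* x (x) y, so that it is the usual quotient of the free abelian group.       *)
Section TensorRelation.
Variables (S R : pzRingType) (M : bimodule S R) (N : lmodType R).

Inductive tensor_rel : seq (M * N) -> seq (M * N) -> Prop :=
| TensorRefl s : tensor_rel s s
| TensorSym s t : tensor_rel s t -> tensor_rel t s
| TensorTrans s t u : tensor_rel s t -> tensor_rel t u -> tensor_rel s u
| TensorCat s s' t t' :
    tensor_rel s s' -> tensor_rel t t' -> tensor_rel (s ++ t) (s' ++ t')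
| TensorCatC s t : tensor_rel (s ++ t) (t ++ s)
| Tensor0 y : tensor_rel [:: (0, y)] [::]
| TensorDl x x' y : tensor_rel [:: (x + x', y)] [:: (x, y); (x', y)]
| TensorDr x y y' : tensor_rel [:: (x, y + y')] [:: (x, y); (x, y')]
| TensorZ x r y : tensor_rel [:: (ract x r, y)] [:: (x, r *: y)].

Definition tensor_relb : rel (seq (M * N)) := fun s t => `[< tensor_rel s t >].

Let tensor_relb_equiv : equiv_class_of tensor_relb.
Proof.
split=> [s|s t|t s u].
- exact/asboolP/TensorRefl.
- by apply/asboolP/asboolP; exact: TensorSym.
- move=> /asboolP st /asboolP tu; exact/asboolP/(TensorTrans st tu).
Qed.

Canonical tensor_relb_equivRel := EquivRelPack tensor_relb_equiv.
Canonical tensor_relb_encModRel := defaultEncModRel tensor_relb.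

Definition tensor : Type := {eq_quot tensor_relb}.

HB.instance Definition _ := Choice.copy tensor {eq_quot tensor_relb}.

Definition tensor_pi (s : seq (M * N)) : tensor := \pi_{eq_quot tensor_relb} s.
Definition tensor_repr (u : tensor) : seq (M * N) :=
  repr (u : {eq_quot tensor_relb}).

Definition tens (x : M) (y : N) : tensor := tensor_pi [:: (x, y)].

Lemma tensor_reprK u : tensor_pi (tensor_repr u) = u.
Proof. exact: reprK. Qed.

Lemma tensor_pi_eq s t : tensor_pi s = tensor_pi t <-> tensor_rel s t.
Proof.
split=> [/eqP|st]; first by rewrite /tensor_pi eqmodE => /asboolP.
by apply/eqP; rewrite /tensor_pi eqmodE; apply/asboolP.
Qed.

Lemma tensor_piK s : tensor_rel (tensor_repr (tensor_pi s)) s.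
Proof. by apply/tensor_pi_eq; rewrite tensor_reprK. Qed.

Lemma tensor_pi_ind (P : tensor -> Prop) :
  (forall s, P (tensor_pi s)) -> forall u, P u.
Proof. by move=> Ppi u; rewrite -(tensor_reprK u). Qed.

Lemma tensor_rel_map (h : M * N -> M * N) :
  (forall y, tensor_rel [:: h (0, y)] [::]) ->
  (forall x x' y, tensor_rel [:: h (x + x', y)] [:: h (x, y); h (x', y)]) ->
  (forall x y y', tensor_rel [:: h (x, y + y')] [:: h (x, y); h (x, y')]) ->
  (forall x r y, tensor_rel [:: h (ract x r, y)] [:: h (x, r *: y)]) ->
  forall s t, tensor_rel s t -> tensor_rel (map h s) (map h t).
Proof.
move=> h0 hDl hDr hZ s t; elim=> {s t} /=.
- by move=> s; exact: TensorRefl.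
- by move=> s t _; exact: TensorSym.
- by move=> s t u _ st _; exact: TensorTrans.
- by move=> s s' t t' _ ss' _ tt'; rewrite !map_cat; exact: TensorCat.
- by move=> s t; rewrite !map_cat; exact: TensorCatC.
- exact: h0.
- exact: hDl.
- exact: hDr.
- exact: hZ.
Qed.

Definition tensor_zero : tensor := tensor_pi [::].
Definition tensor_add (u v : tensor) : tensor :=
  tensor_pi (tensor_repr u ++ tensor_repr v).
Definition tensor_opp (u : tensor) : tensor :=
  tensor_pi [seq (- p.1, p.2) | p <- tensor_repr u].
Definition tensor_scale (a : S) (u : tensor) : tensor :=
  tensor_pi [seq (a *: p.1, p.2) | p <- tensor_repr u].

Lemma tensor_add_pi s t : tensor_add (tensor_pi s) (tensor_pi t) = tensor_pi (s ++ t).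
Proof. by apply/tensor_pi_eq/TensorCat; exact: tensor_piK. Qed.

Lemma tensor_opp_pi s :
  tensor_opp (tensor_pi s) = tensor_pi [seq (- p.1, p.2) | p <- s].
Proof.
apply/tensor_pi_eq/tensor_rel_map/tensor_piK.
- by move=> y; rewrite oppr0; exact: Tensor0.
- by move=> x x' y; rewrite opprD; exact: TensorDl.
- by move=> x y y'; exact: TensorDr.
- move=> x r y /=.
  have -> : - ract x r = ract (- x) r :> M by rewrite -!scaleN1r ractZ.
  exact: TensorZ.
Qed.

Lemma tensor_scale_pi a s :
  tensor_scale a (tensor_pi s) = tensor_pi [seq (a *: p.1, p.2) | p <- s].
Proof.
apply/tensor_pi_eq/tensor_rel_map/tensor_piK.
- by move=> y; rewrite scaler0; exact: Tensor0.
- by move=> x x' y; rewrite scalerDr; exact: TensorDl.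
- by move=> x y y'; exact: TensorDr.
- by move=> x r y; rewrite -ractZ; exact: TensorZ.
Qed.

Let tensor_addA : associative tensor_add.
Proof.
elim/tensor_pi_ind=> s; elim/tensor_pi_ind=> t; elim/tensor_pi_ind=> u.
by rewrite !tensor_add_pi catA.
Qed.
Let tensor_addC : commutative tensor_add.
Proof.
elim/tensor_pi_ind=> s; elim/tensor_pi_ind=> t.
by rewrite !tensor_add_pi; apply/tensor_pi_eq/TensorCatC.
Qed.
Let tensor_add0 : left_id tensor_zero tensor_add.
Proof. by elim/tensor_pi_ind=> s; rewrite tensor_add_pi. Qed.
Let tensor_addN : left_inverse tensor_zero tensor_opp tensor_add.
Proof.
elim/tensor_pi_ind=> s; rewrite tensor_opp_pi tensor_add_pi; apply/tensor_pi_eq.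
elim: s => [|[x y] s IHs]; first exact: TensorRefl.
rewrite /= -cat1s.
set t := map _ s in IHs *.
apply: TensorTrans (TensorCat (TensorRefl _) (TensorCatC t ((x, y) :: s))) _.
rewrite /= -[[:: _, _ & _]]/([:: (- x, y); (x, y)] ++ (s ++ t)) -[[::]]/([::] ++ [::]).
apply: TensorCat; last exact: TensorTrans (TensorCatC _ _) IHs.
apply: TensorTrans (TensorSym (TensorDl _ _ _)) _.
by rewrite addNr; exact: Tensor0.
Qed.

HB.instance Definition _ :=
  GRing.isZmodule.Build tensor tensor_addA tensor_addC tensor_add0 tensor_addN.

Lemma tensor_piD s t : tensor_pi (s ++ t) = tensor_pi s + tensor_pi t.
Proof. by rewrite -tensor_add_pi. Qed.

Lemma tensor_piE s : tensor_pi s = \sum_(p <- s) tens p.1 p.2.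
Proof.
elim: s => [|[x y] s IHs]; first by rewrite big_nil.
by rewrite big_cons -IHs -tensor_piD.
Qed.

Let tensor_scaleA a b u : tensor_scale a (tensor_scale b u) = tensor_scale (a * b) u.
Proof.
elim/tensor_pi_ind: u => s; rewrite !tensor_scale_pi -map_comp.
by congr tensor_pi; apply: eq_map => p /=; rewrite scalerA.
Qed.
Let tensor_scale1 : left_id 1 tensor_scale.
Proof.
elim/tensor_pi_ind=> s; rewrite tensor_scale_pi map_id_in //.
by move=> [x y] _; rewrite scale1r.
Qed.
Let tensor_scaleDr : right_distributive tensor_scale +%R.
Proof.
move=> a; elim/tensor_pi_ind=> s; elim/tensor_pi_ind=> t.
by rewrite -tensor_piD !tensor_scale_pi map_cat tensor_piD.
Qed.
Let tensor_scaleDl u : {morph tensor_scale^~ u : a b / a + b}.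
Proof.
elim/tensor_pi_ind: u => s a b; rewrite !tensor_scale_pi.
rewrite !tensor_piE !big_map -big_split /=; apply: eq_bigr => -[x y] _ /=.
by rewrite scalerDl -tensor_piD; apply/tensor_pi_eq/TensorDl.
Qed.

HB.instance Definition _ := GRing.Zmodule_isLmodule.Build S tensor
  tensor_scaleA tensor_scale1 tensor_scaleDr tensor_scaleDl.

Lemma tensorZ a x y : a *: tens x y = tens (a *: x) y.
Proof. exact: tensor_scale_pi. Qed.

Section Lift.
Variables (V : zmodType) (b : M -> N -> V).
Hypothesis bDl : forall x x' y, b (x + x') y = b x y + b x' y.
Hypothesis bDr : forall x y y', b x (y + y') = b x y + b x y'.
Hypothesis bZ : forall x r y, b (ract x r) y = b x (r *: y).

Definition tensor_lift (u : tensor) : V := \sum_(p <- tensor_repr u) b p.1 p.2.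

Lemma tensor_lift_pi s : tensor_lift (tensor_pi s) = \sum_(p <- s) b p.1 p.2.
Proof.
suff E t t' : tensor_rel t t' ->
    \sum_(p <- t) b p.1 p.2 = \sum_(p <- t') b p.1 p.2 by exact/E/tensor_piK.
elim=> {s t t'} //=.
- by move=> s t u _ -> _ ->.
- by move=> s s' t t' _ st _ st'; rewrite !big_cat /= st st'.
- by move=> s t; rewrite !big_cat /= addrC.
- move=> y; rewrite big_seq1 big_nil.
  by apply: (addrI (b 0 y)); rewrite /= -bDl !addr0.
- by move=> x x' y; rewrite big_seq1 big_cons big_seq1 bDl.
- by move=> x y y'; rewrite big_seq1 big_cons big_seq1 bDr.
- by move=> x r y; rewrite !big_seq1 bZ.
Qed.

Lemma tensor_liftE x y : tensor_lift (tens x y) = b x y.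
Proof. by rewrite tensor_lift_pi big_seq1. Qed.

Lemma tensor_liftD : {morph tensor_lift : u v / u + v}.
Proof.
elim/tensor_pi_ind=> s; elim/tensor_pi_ind=> t.
by rewrite -tensor_piD !tensor_lift_pi big_cat.
Qed.

End Lift.

End TensorRelation.

Section TensorBimodule.
Variables (S R T : pzRingType) (M : bimodule S R) (N : bimodule R T).

Definition tensor_ract (u : tensor M N) (t : T) : tensor M N :=
  tensor_pi [seq (p.1, ract p.2 t) | p <- tensor_repr u].

Lemma tensor_ract_pi s t :
  tensor_ract (tensor_pi s) t = tensor_pi [seq (p.1, ract p.2 t) | p <- s].
Proof.
apply/tensor_pi_eq/tensor_rel_map/tensor_piK.
- by move=> y; exact: Tensor0.
- by move=> x x' y; exact: TensorDl.
- by move=> x y y'; rewrite ractDl; exact: TensorDr.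
- by move=> x r y; rewrite ractZ; exact: TensorZ.
Qed.

Let tensor_ract1 u : tensor_ract u 1 = u.
Proof.
elim/tensor_pi_ind: u => s; rewrite tensor_ract_pi map_id_in //.
by move=> [x y] _; rewrite ract1.
Qed.
Let tensor_ractM u s t : tensor_ract u (s * t) = tensor_ract (tensor_ract u s) t.
Proof.
elim/tensor_pi_ind: u => z; rewrite !tensor_ract_pi -map_comp.
by congr tensor_pi; apply: eq_map => p /=; rewrite ractM.
Qed.
Let tensor_ractDl u v t : tensor_ract (u + v) t = tensor_ract u t + tensor_ract v t.
Proof.
elim/tensor_pi_ind: u => y; elim/tensor_pi_ind: v => z.
by rewrite -tensor_piD !tensor_ract_pi map_cat tensor_piD.
Qed.
Let tensor_ractDr u s t : tensor_ract u (s + t) = tensor_ract u s + tensor_ract u t.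
Proof.
elim/tensor_pi_ind: u => z; rewrite !tensor_ract_pi.
rewrite !tensor_piE !big_map -big_split /=; apply: eq_bigr => -[x y] _ /=.
by rewrite ractDr -tensor_piD; apply/tensor_pi_eq/TensorDr.
Qed.
Let tensor_ractZ a u t : tensor_ract (a *: u) t = a *: tensor_ract u t.
Proof.
elim/tensor_pi_ind: u => s.
rewrite -[a *: _]/(tensor_scale a _) -[a *: _]/(tensor_scale a _).
by rewrite tensor_ract_pi !tensor_scale_pi tensor_ract_pi -!map_comp.
Qed.

Definition tensor_bimod : bimodule S T :=
  @Bimodule S T (tensor M N) tensor_ract tensor_ract1 tensor_ractM tensor_ractDl
    tensor_ractDr tensor_ractZ.

End TensorBimodule.

Section Extension.
Variables (R A : pzRingType) (phi : {rmorphism R -> A}).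

Definition ext_AR : bimodule A R := rrestr_bimod phi (reg_bimod A).
Definition ext_RA : bimodule R A := lrestr_bimod phi (reg_bimod A).
Definition ext_RR : bimodule R R := lrestr_bimod phi ext_AR.

Definition frobenius : Prop :=
  [/\ finitely_generated (restr phi A^o),
      projective (restr phi A^o)
    & bimod_iso ext_AR (hom_bimod ext_RA (reg_bimod R))].

Definition ext_tensor : bimodule A A := tensor_bimod ext_AR ext_RA.

Definition ext_mul : ext_tensor -> reg_bimod A :=
  @tensor_lift A R ext_AR ext_RA A (fun a b : A => a * b).

Lemma ext_mulE (a b : A) : ext_mul (@tens _ _ ext_AR ext_RA a b) = a * b.
Proof.
apply: tensor_liftE => /=; [exact: mulrDl|exact: mulrDr|].
by move=> x r y; exact/esym/mulrA.
Qed.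

Let ext_mul_pi s :
  ext_mul (tensor_pi s) = \sum_(p <- s) (p.1 : A) * (p.2 : A) :> A.
Proof.
apply: tensor_lift_pi => /=; [exact: mulrDl|exact: mulrDr|].
by move=> x r y; exact/esym/mulrA.
Qed.

Let ext_mul_linear : linear ext_mul.
Proof.
move=> a; elim/tensor_pi_ind=> s; elim/tensor_pi_ind=> t.
rewrite -[a *: tensor_pi s]/(tensor_scale a _) tensor_scale_pi -tensor_piD.
rewrite !ext_mul_pi big_cat big_map /=; congr (_ + _).
by rewrite -[RHS]/(a * _) mulr_sumr; apply: eq_bigr => p _; exact/esym/mulrA.
Qed.

HB.instance Definition _ :=
  GRing.isLinear.Build A ext_tensor (reg_bimod A) *:%R ext_mul ext_mul_linear.

Lemma ext_mul_bimod_hom : bimod_hom ext_mul.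
Proof.
elim/tensor_pi_ind=> s a.
rewrite -[ract _ a]/(tensor_ract _ a) tensor_ract_pi -[RHS]/((_ : A) * a).
rewrite /= !ext_mul_pi big_map mulr_suml; apply: eq_bigr => p _; exact: mulrA.
Qed.

Definition separable : Prop :=
  exists s : {linear reg_bimod A -> ext_tensor},
    bimod_hom s /\ cancel s ext_mul.

Definition split_extension : Prop :=
  exists M : bimodule R R, bimod_iso ext_RR (sum_bimod (reg_bimod R) M).

End Extension.

(* Main.v *)
From HB Require Import structures.
From mathcomp Require Import all_boot all_algebra.
From mathcomp Require Import boolp functions.
Require Import Defs.
Set Implicit Arguments.
Unset Strict Implicit.
Unset Printing Implicit Defensive.
Import GRing.Theory.
Local Open Scope ring_scope.

(** Both parts follow one pattern.  A functor G between the module categories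
    preserves n-torsionfree modules, finite generation and direct sums, and
    every n-torsionfree module N on the target side is a retract of G(M) for an
    n-torsionfree M.  Writing M as a sum of indecomposables, which are again
    n-torsionfree and so belong to a finite list Z_1, ..., Z_p, exhibits N as a
    retract of a sum of copies of the G(Z_k); if N is indecomposable, KRS forces
    N to be one of the indecomposable summands of some G(Z_k)
    (finite_rep_type_transfer).

    For part (1), G is induction from R to A and M is the restriction of N:
    separability splits the canonical map between N and G(M).  For part (2), G
    is restriction, M is induced from N, and the splitting of A over R gives the
    retraction.  As the extension is Frobenius, induction is isomorphic to
    coinduction Hom_R(A, -), which is used throughout; its exactness is just
    projectivity of A.

    That restriction and coinduction preserve torsionfreeness (TF_restr,
    TF_coind) rests on the Frobenius form E : A -> R with its dual bases x, y.
    These yield natural isomorphisms between the dual of the restriction (or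
    coinduction) of P and the restriction (or coinduction) of the dual of P, as
    right modules.  So the functors commute with the transpose; being exact and
    preserving projectives, they carry a resolution of the transpose over one
    ring to a resolution over the other, and dual bases show that vanishing
    cohomology of its dual is preserved.  The Frobenius data are symmetric
    between left and right, so the same lemmas apply on both sides.

    That retracts of n-torsionfree modules are n-torsionfree (TF_retract) is a
    statement about arbitrary presentations: the transpose of a retract is a
    retract of the transpose up to maps factoring through projectives, and such
    stable retracts pass to syzygies, hence inherit the vanishing of Ext in
    positive degrees. *)

(** * Linear maps, kernels and cokernels *)

Definition mk_linear (R : pzRingType) (M N : lmodType R) (f : M -> N)
    (f_lin : linear f) : {linear M -> N} :=
  HB.pack f (GRing.isLinear.Build R M N *:%R f f_lin).

Definition surj (T U : Type) (f : T -> U) : Prop := forall y, exists x, f x = y.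

Lemma surj_section (T U : Type) (f : T -> U) :
  surj f -> exists g : U -> T, cancel g f.
Proof. by move=> fS; have [g gP] := choice fS; exists g. Qed.

Lemma inj_surj_bij (T U : Type) (f : T -> U) :
  injective f -> surj f -> bijective f.
Proof.
by move=> fI /surj_section[g gK]; exists g => // x; apply: fI; rewrite gK.
Qed.

Lemma bij_surj (T U : Type) (f : T -> U) : bijective f -> surj f.
Proof. by case=> g _ gK y; exists (g y). Qed.

Section LinearMaps.
Variable R : pzRingType.
Implicit Types M N L P : lmodType R.

Lemma linear_inv M N (f : {linear M -> N}) :
  bijective f -> exists g : {linear N -> M}, cancel f g /\ cancel g f.
Proof.
case=> g fK gK; have g_lin : linear g.
  by move=> r x y; apply: (can_inj fK); rewrite linearP !gK.
by exists (mk_linear g_lin).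
Qed.

Lemma copair_is_linear M N L (f : {linear M -> L}) (g : {linear N -> L}) :
  linear (fun u : M * N => f u.1 + g u.2).
Proof. by move=> r [x y] [x' y']; rewrite !linearP /= scalerDr addrACA. Qed.
Definition copair M N L (f : {linear M -> L}) (g : {linear N -> L}) :
  {linear (M * N)%type -> L} := mk_linear (copair_is_linear f g).

Lemma inl_is_linear M N : linear (fun x : M => (x, 0 : N)).
Proof.
move=> r x y; rewrite -[r *: (x, 0)]/(r *: x, r *: 0).
by rewrite -[_ + _ in RHS]/(_ + _, _ + _) /= scaler0 addr0.
Qed.
Lemma inr_is_linear M N : linear (fun y : N => (0 : M, y)).
Proof.
move=> r x y; rewrite -[r *: (0, x)]/(r *: 0, r *: x).
by rewrite -[_ + _ in RHS]/(_ + _, _ + _) /= scaler0 addr0.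
Qed.
Definition inl_linear M N := mk_linear (@inl_is_linear M N).
Definition inr_linear M N := mk_linear (@inr_is_linear M N).

End LinearMaps.

Section Kernel.
Variables (R : pzRingType) (M N : lmodType R) (f : {linear M -> N}).

Definition ker_pred : {pred M} := fun x => f x == 0.

Lemma ker_submod_closed : GRing.submod_closed ker_pred.
Proof.
split=> [|r x y]; first by rewrite unfold_in /= linear0.
by rewrite !unfold_in linearP => /eqP-> /eqP->; rewrite scaler0 addr0.
Qed.
HB.instance Definition _ :=
  GRing.isSubmodClosed.Build R M ker_pred ker_submod_closed.

Record ker : Type := Ker { ker_val : M; _ : ker_val \in ker_pred }.
HB.instance Definition _ := [isSub for ker_val].
HB.instance Definition _ := [Choice of ker by <:].
HB.instance Definition _ := [SubChoice_isSubLmodule of ker by <:].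

Definition ker_incl : {linear ker -> M} := val.

Lemma ker_inclP u : f (ker_incl u) = 0.
Proof. exact/eqP/(valP u). Qed.

Lemma ker_incl_inj : injective ker_incl. Proof. exact: val_inj. Qed.

Section KerLift.
Variables (L : lmodType R) (g : {linear L -> M}) (gP : forall x, f (g x) = 0).

Lemma ker_lift_subproof x : g x \in ker_pred.
Proof. by rewrite unfold_in gP eqxx. Qed.
Lemma ker_lift_is_linear : linear (fun x => Ker (ker_lift_subproof x)).
Proof.
by move=> r x y; apply: ker_incl_inj; rewrite [RHS]linearP; exact: linearP.
Qed.
Definition ker_lift : {linear L -> ker} := mk_linear ker_lift_is_linear.
Lemma ker_liftE x : ker_incl (ker_lift x) = g x. Proof. by []. Qed.

End KerLift.
End Kernel.
Arguments ker_incl_inj {R M N f} [x1 x2].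

Section CokernelMaps.
Variables (R : pzRingType) (M N : lmodType R) (f : {linear M -> N}).

Lemma coker_pi_is_linear : linear (coker_pi f).
Proof. by move=> r x y; rewrite coker_piD coker_piZ. Qed.
Definition coker_proj : {linear N -> coker f} := mk_linear coker_pi_is_linear.

Lemma coker_proj_surj : surj coker_proj.
Proof. by elim/coker_ind=> y; exists y. Qed.

Lemma coker_proj_exact : exact_at f coker_proj.
Proof.
move=> y; rewrite -[coker_proj y]/(coker_pi f y).
have -> : 0 = coker_pi f 0 by rewrite -[RHS]/(coker_proj 0) linear0.
by rewrite coker_pi_eq subr0.
Qed.

Variables (L : lmodType R) (g : {linear N -> L}).
Hypothesis gf0 : forall x, g (f x) = 0.

Lemma coker_factor :
  exists h : {linear coker f -> L}, forall y, h (coker_proj y) = g y.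
Proof.
have [s sK] := surj_section coker_proj_surj.
have E y : g (s (coker_proj y)) = g y.
  have : coker_pi f (s (coker_proj y)) = coker_pi f y by exact: sK.
  case/coker_pi_eq=> x fx; apply/eqP; rewrite -subr_eq0 -linearB -fx.
  by rewrite gf0.
have h_lin : linear (fun u => g (s u)).
  move=> r u v; rewrite -(sK u) -(sK v) -linearP !E.
  by rewrite linearP.
by exists (mk_linear h_lin) => y; exact: E.
Qed.

End CokernelMaps.

Lemma coker_iso (R : pzRingType) (M N L : lmodType R) (f : {linear M -> N})
    (v : {linear N -> L}) : surj v -> exact_at f v -> lmod_iso (coker f) L.
Proof.
move=> vS fv; have vf0 x : v (f x) = 0 by apply/fv; exists x.
have [h hE] := coker_factor vf0; exists h; apply: inj_surj_bij.
  apply: raddf_inj => u hu0; have [y yu] := coker_proj_surj u.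
  have gy0 : v y = 0 by rewrite -hE yu.
  by rewrite -yu; apply/coker_proj_exact/fv.
by move=> z; have [y <-] := vS z; exists (coker_proj f y); exact: hE.
Qed.

(** * Projective modules *)

Section Projective.
Variable R : pzRingType.
Implicit Types M N L P Q X Y Z : lmodType R.

(** Corestricting d to the kernel of e turns it into a surjection, to which
    projectivity applies. *)
Lemma projective_lift_exact P X Y Z (d : {linear X -> Y}) (e : {linear Y -> Z})
    (f : {linear P -> Y}) :
  projective P -> exact_at d e -> (forall x, e (f x) = 0) ->
  exists h : {linear P -> X}, forall x, d (h x) = f x.
Proof.
move=> Pp de ef0; have ed0 x : e (d x) = 0 by apply/de; exists x.
have dS : surj (ker_lift ed0).
  move=> u; have [x dx] := (de (ker_incl e u)).1 (ker_inclP u).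
  by exists x; apply: ker_incl_inj; rewrite ker_liftE.
have [h hE] := Pp _ _ _ (ker_lift ef0) dS; exists h => x.
by rewrite -(ker_liftE ed0) hE.
Qed.

Lemma projective_prod P Q :
  projective P -> projective Q -> projective (P * Q)%type.
Proof.
move=> Pp Qp M N p g pS.
have [h hE] := Pp M N p (g \o inl_linear P Q) pS.
have [k kE] := Qp M N p (g \o inr_linear P Q) pS.
exists (copair h k) => -[x y] /=; rewrite linearD hE kE /= -linearD.
by congr (g _); rewrite -[LHS]/(_ + _, _ + _) /= addr0 add0r.
Qed.

Lemma finitely_generated_finType M (I : finType) (v : I -> M) :
  (forall x, exists c : I -> R, x = \sum_i c i *: v i) -> finitely_generated M.
Proof.
move=> vP; exists #|I|, (v \o enum_val) => x; have [c ->] := vP x.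
exists (c \o enum_val); rewrite (reindex (@enum_val I I)) //=.
exact/onW_bij/enum_val_bij.
Qed.

Lemma finitely_generated_surj M N (f : {linear M -> N}) :
  surj f -> finitely_generated M -> finitely_generated N.
Proof.
move=> fS [n [v vP]]; exists n, (f \o v) => y; have [x <-] := fS y.
have [c ->] := vP x; exists c; rewrite linear_sum; apply: eq_bigr => i _.
by rewrite linearZ.
Qed.

Lemma finitely_generated_prod M N :
  finitely_generated M -> finitely_generated N ->
  finitely_generated (M * N)%type.
Proof.
move=> [m [v vP]] [n [w wP]].
pose u (i : 'I_m + 'I_n) : (M * N)%type :=
  match i with inl i => inl_linear M N (v i) | inr j => inr_linear M N (w j) end.
apply: (@finitely_generated_finType _ _ u) => -[x y].
have [c cE] := vP x; have [d dE] := wP y.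
exists (fun i => match i with inl i => c i | inr j => d j end).
have -> : (x, y) = inl_linear M N x + inr_linear M N y.
  by rewrite -[RHS]/(_ + _, _ + _) /= addr0 add0r.
rewrite big_sumType; congr (_ + _).
  by rewrite [in LHS]cE linear_sum; apply: eq_bigr => i _; rewrite linearZ.
by rewrite [in LHS]dE linear_sum; apply: eq_bigr => i _; rewrite linearZ.
Qed.

Lemma dsum_sumE n (X : 'I_n -> lmodType R) (J : Type) (r : seq J)
    (F : J -> dsum X) i : (\sum_(j <- r) F j) i = \sum_(j <- r) F j i.
Proof. by elim/big_rec2: _ => // j x y _ <-. Qed.

(** Projectivity of a finitely generated module is witnessed by a finite dual
    basis, a form in which it passes to the dual and along ring extensions. *)
Lemma dual_basis P : finitely_generated P -> projective P ->
  exists n (v : 'I_n -> P) (c : 'I_n -> {linear P -> R^o}),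
    forall x, x = \sum_i (c i x : R) *: v i.
Proof.
move=> [n [v vP]] Pp; pose F : lmodType R := dsum (fun _ : 'I_n => R^o).
have p_lin : linear (fun u : F => \sum_i (u i : R) *: v i).
  move=> r u w; rewrite scaler_sumr -big_split; apply: eq_bigr => i _ /=.
  by rewrite scalerA -scalerDl.
have pS : surj (mk_linear p_lin).
  by move=> x; have [c ->] := vP x; exists (c : F).
have [h hE] := Pp _ _ _ idfun pS.
have c_lin i : linear (fun x => h x i) by move=> r x y; rewrite linearP.
by exists n, v, (fun i => mk_linear (c_lin i)) => x; rewrite -[LHS]hE.
Qed.

Lemma dual_basis_projective P n (v : 'I_n -> P) (c : 'I_n -> {linear P -> R^o}) :
  (forall x, x = \sum_i (c i x : R) *: v i) -> projective P.
Proof.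
move=> vP M N p g pS; have [s sK] := surj_section pS.
have h_lin : linear (fun x => \sum_i (c i x : R) *: s (g (v i))).
  move=> r x y; rewrite scaler_sumr -big_split; apply: eq_bigr => i _ /=.
  by rewrite linearP scalerDl scalerA.
exists (mk_linear h_lin) => x; rewrite {2}[x]vP !linear_sum.
by apply: eq_bigr => i _; rewrite !linearZ /= sK.
Qed.

End Projective.

Lemma hom_sumE (R : pzRingType) (M N : lmodType R) (J : Type) (r : seq J)
    (F : J -> hom M N) x : (\sum_(j <- r) F j) x = \sum_(j <- r) F j x.
Proof. by elim/big_rec2: _ => // j y f _ <-. Qed.

Lemma dual_sumE (R : pzRingType) (M : lmodType R) (J : Type) (r : seq J)
    (F : J -> dual M) x : (\sum_(j <- r) F j) x = \sum_(j <- r) F j x.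
Proof. by elim/big_rec2: _ => // j y f _ <-. Qed.

(** The coordinate functions c of a dual basis generate the dual, with the
    evaluations at the v as their coordinate functions. *)
Lemma projective_dual (R : pzRingType) (P : lmodType R) :
  finitely_generated P -> projective P -> projective (dual P).
Proof.
move=> Pfg /(dual_basis Pfg)[n [v [c cE]]].
have ev_lin i : linear (fun g : dual P => g (v i) : (R^c)^o) by move=> r f g.
apply: (@dual_basis_projective _ (dual P) n c (fun i => mk_linear (ev_lin i))).
move=> g; apply: hom_ext => x; rewrite dual_sumE {1}[x]cE linear_sum.
by apply: eq_bigr => i _; rewrite linearZ.
Qed.

(** * Free modules and projective resolutions *)

(** The free module on T consists of the finitely supported functions; the
    value of a linear extension is a sum over any duplicate-free support. *)
Section FreeModule.
Variables (R : pzRingType) (T : choiceType).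

Definition supported (s : seq T) (f : T -> R^o) : Prop :=
  forall x, x \notin s -> f x = 0.

Definition finsupp_pred : {pred T -> R^o} :=
  fun f => `[< exists s, supported s f >].

Lemma finsupp_submod_closed : GRing.submod_closed finsupp_pred.
Proof.
split=> [|r f g]; first by apply/asboolP; exists [::].
move=> /asboolP[s sf] /asboolP[t tg]; apply/asboolP; exists (s ++ t) => x.
rewrite mem_cat negb_or => /andP[/sf fx /tg gx].
by rewrite -[LHS]/(r *: f x + g x) fx gx scaler0 addr0.
Qed.
HB.instance Definition _ :=
  GRing.isSubmodClosed.Build R (T -> R^o) finsupp_pred finsupp_submod_closed.

Record free_module : Type :=
  FreeModule { free_val : T -> R^o; _ : free_val \in finsupp_pred }.
HB.instance Definition _ := [isSub for free_val].
HB.instance Definition _ := [Choice of free_module by <:].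
HB.instance Definition _ := [SubChoice_isSubLmodule of free_module by <:].

Lemma free_support (u : free_module) : exists s, supported s (free_val u).
Proof. exact/asboolP/(valP u). Qed.

Lemma free_valP r (u v : free_module) x :
  free_val (r *: u + v) x = r * (free_val u x : R) + (free_val v x : R).
Proof. by []. Qed.

Lemma free_sumE (J : Type) (r : seq J) (F : J -> free_module) x :
  free_val (\sum_(j <- r) F j) x = \sum_(j <- r) (free_val (F j) x : R).
Proof. by elim/big_rec2: _ => // j y u _ <-. Qed.

Lemma free_basis_subproof (x : T) :
  (fun y => (y == x)%:R : R^o) \in finsupp_pred.
Proof.
by apply/asboolP; exists [:: x] => y; rewrite inE => /negbTE->.
Qed.
Definition free_basis x : free_module := FreeModule (free_basis_subproof x).

Section Extend.
Variables (M : lmodType R) (g : T -> M).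

Definition free_eval (u : free_module) : M :=
  \sum_(x <- undup (projT1 (cid (free_support u)))) (free_val u x : R) *: g x.

Lemma free_evalE (s : seq T) (u : free_module) :
  uniq s -> supported s (free_val u) ->
  free_eval u = \sum_(x <- s) (free_val u x : R) *: g x.
Proof.
rewrite /free_eval; case: cid => /= t tu sU su.
have E (r : seq T) : uniq r -> supported r (free_val u) ->
    \sum_(x <- r) (free_val u x : R) *: g x =
    \sum_(x <- undup (s ++ t) | x \in r) (free_val u x : R) *: g x.
  move=> rU ru; rewrite (bigID (fun x => x \in s ++ t)) /=.
  rewrite [X in _ + X]big1 ?addr0; last first.
    move=> x; rewrite mem_cat negb_or => /andP[/su -> _]; exact: scale0r.
  rewrite -[LHS]big_filter -[RHS]big_filter; apply/perm_big/uniq_perm.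
  - exact: filter_uniq.
  - exact/filter_uniq/undup_uniq.
  - by move=> x; rewrite !mem_filter mem_undup andbC.
rewrite !E ?undup_uniq //; last by move=> x; rewrite mem_undup => /tu.
rewrite big_mkcond [RHS]big_mkcond; apply: eq_bigr => x _; rewrite mem_undup.
have [_|/su fx0] := boolP (x \in s); have [_|/tu fx0'] := boolP (x \in t) => //.
  by rewrite fx0' scale0r.
by rewrite fx0 scale0r.
Qed.

Lemma free_eval_is_linear : linear free_eval.
Proof.
move=> r u v; have [s su] := free_support u; have [t tv] := free_support v.
pose w := undup (s ++ t); have wU : uniq w := undup_uniq _.
have wu : supported w (free_val u).
  by move=> x; rewrite mem_undup mem_cat negb_or => /andP[/su].
have wv : supported w (free_val v).
  by move=> x; rewrite mem_undup mem_cat negb_or => /andP[_ /tv].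
have wD : supported w (free_val (r *: u + v)).
  by move=> x xw; rewrite free_valP wu // wv // mulr0 addr0.
rewrite !(free_evalE wU) // scaler_sumr -big_split; apply: eq_bigr => x _ /=.
by rewrite scalerA -scalerDl.
Qed.

Definition free_extend : {linear free_module -> M} :=
  mk_linear free_eval_is_linear.

Lemma free_extend_basis x : free_extend (free_basis x) = g x.
Proof.
rewrite -[LHS]/(free_eval _) (@free_evalE [:: x]) //.
  by rewrite big_seq1 /= eqxx scale1r.
by move=> y; rewrite inE /= => /negbTE->.
Qed.

End Extend.

Lemma free_module_projective : projective free_module.
Proof.
move=> M N p g pS; have [s sK] := surj_section pS.
pose gb x := g (free_basis x); exists (free_extend (s \o gb)) => u.
have [t tu] := free_support u; pose w := undup t.
have wu : supported w (free_val u) by move=> x; rewrite mem_undup => /tu.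
have wU : uniq w := undup_uniq t.
have -> : g u = g (\sum_(x <- w) (free_val u x : R) *: free_basis x).
  congr (g _); apply: val_inj; apply: funext => y; rewrite -[RHS]/(free_val _ y).
  rewrite free_sumE.
  under eq_bigr do rewrite -[free_val _ y]/((free_val u _ : R) * (y == _)%:R).
  have [yw|yw] := boolP (y \in w); last first.
    rewrite [LHS]wu // big_seq big1 // => x xw.
    by rewrite (_ : y == x = false) ?mulr0 //; apply: contraNF yw => /eqP->.
  rewrite (bigD1_seq y) //= big1 => [|x xy]; first by rewrite eqxx mulr1 addr0.
  by rewrite eq_sym (negbTE xy) mulr0.
rewrite -[free_extend _ u]/(free_eval _ u) (free_evalE _ wU wu) !linear_sum.
by apply: eq_bigr => x _; rewrite !linearZ /= sK.
Qed.

End FreeModule.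

Lemma enough_projectives (R : pzRingType) (M : lmodType R) :
  exists (P : lmodType R) (p : {linear P -> M}), projective P /\ surj p.
Proof.
exists (free_module R M), (free_extend (@id M)).
split=> [|x]; first exact: free_module_projective.
by exists (free_basis R x); rewrite free_extend_basis.
Qed.

Section Resolution.
Variables (R : pzRingType).

Definition cover (M : lmodType R) : lmodType R :=
  projT1 (cid (enough_projectives M)).
Definition cover_map (M : lmodType R) : {linear cover M -> M} :=
  projT1 (cid (projT2 (cid (enough_projectives M)))).
Lemma cover_projective M : projective (cover M).
Proof. by rewrite /cover; case: cid => P /= /cid[p []]. Qed.
Lemma cover_map_surj M : surj (@cover_map M).
Proof. exact: (projT2 (cid (projT2 (cid (enough_projectives M))))).2. Qed.

Fixpoint syzygy (M : lmodType R) (i : nat) : lmodType R :=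
  if i is j.+1 then ker (@cover_map (syzygy M j)) else M.

Lemma resolution_exists (M : lmodType R) : inhabited (proj_resolution M).
Proof.
pose d i : {linear cover (syzygy M i.+1) -> cover (syzygy M i)} :=
  ker_incl (@cover_map (syzygy M i)) \o @cover_map (syzygy M i.+1).
have d_exact i : exact_at (d i) (@cover_map (syzygy M i)).
  move=> y; split=> [y0|[x <-]]; last exact: ker_inclP.
  have /eqP yk := y0; have [x xE] := cover_map_surj (Ker yk : syzygy M i.+1).
  by exists x; rewrite /= xE.
constructor; apply: (@ProjResolution R M (fun i => cover (syzygy M i)) d
  (@cover_map M)) => [i|||i].
- exact: cover_projective.
- exact: cover_map_surj.
- exact: d_exact.
- move=> y; rewrite -(d_exact i.+1 y); split=> y0.
    by apply: ker_incl_inj; rewrite linear0.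
  by rewrite -[LHS]/(ker_incl _ (cover_map _ y)) y0 linear0.
Qed.

End Resolution.

(** * Stable retracts and the vanishing of Ext *)

Section StableRetract.
Variable R : pzRingType.
Implicit Types T L P Q : lmodType R.

(** A retract in the stable category, where maps factoring through a
    projective module count as zero. *)
Definition stable_retract T T' : Prop :=
  exists (Q : lmodType R) (a : {linear T -> T'}) (b : {linear T' -> T})
    (k : {linear T -> Q}) (l : {linear Q -> T}),
    projective Q /\ forall x, b (a x) = x + l (k x).

Lemma stable_retract_iso T T' : lmod_iso T T' -> stable_retract T T'.
Proof.
case=> a /linear_inv[b [aK _]].
exists (free_module R T), a, b, \0, \0; split; first exact: free_module_projective.
by move=> x; rewrite aK /= addr0.
Qed.

(** Lifts a0 and b0 of the two maps to P and P' restrict to the syzygies.  On P,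
    b0 a0 - 1 differs by a map h into the syzygy from a map through Q, and the
    latter vanishes on the syzygy because it factors through e. *)
Lemma syzygy_comparison T T' P P' (e : {linear P -> T}) (e' : {linear P' -> T'}) :
  projective P -> projective P' -> surj e -> surj e' -> stable_retract T T' ->
  exists (a0 : {linear P -> P'}) (a1 : {linear ker e -> ker e'})
    (b1 : {linear ker e' -> ker e}) (h : {linear P -> ker e}),
    (forall u, ker_incl e' (a1 u) = a0 (ker_incl e u)) /\
    forall u, b1 (a1 u) = u + h (ker_incl e u).
Proof.
move=> Pp Pp' eS eS' [Q [a [b [k [l [Qp abE]]]]]].
have [a0 a0E] := Pp _ _ e' (a \o e) eS'.
have [b0 b0E] := Pp' _ _ e (b \o e') eS.
have [s sE] := Qp _ _ e l eS.
pose m : {linear P -> P} := ((b0 \o a0) \- idfun) \- (s \o (k \o e)).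
have em x : e (m x) = 0.
  rewrite /m /= !linearB /= b0E /= a0E /= abE sE addrAC addrK.
  exact: subrr.
have a1P u : e' ((a0 \o ker_incl e) u) = 0 by rewrite /= a0E /= ker_inclP linear0.
have b1P u : e ((b0 \o ker_incl e') u) = 0 by rewrite /= b0E /= ker_inclP linear0.
exists a0, (ker_lift a1P), (ker_lift b1P), (ker_lift em); split=> // u.
have hE v : ker_incl e (ker_lift em v) = b0 (a0 v) - v - s (k (e v)) by [].
apply: ker_incl_inj; rewrite linearD hE ker_inclP !linear0 addr0.
by rewrite [RHS]addrC subrK.
Qed.

(** On the syzygies, the composite differs from 1 by a map through P. *)
Lemma stable_retract_ker T T' P P' (e : {linear P -> T}) (e' : {linear P' -> T'}) :
  projective P -> projective P' -> surj e -> surj e' ->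
  stable_retract T T' -> stable_retract (ker e) (ker e').
Proof.
move=> Pp Pp' eS eS' TT'.
have [a0 [a1 [b1 [h [_ abE]]]]] := syzygy_comparison Pp Pp' eS eS' TT'.
by exists P, a1, b1, (ker_incl e), h.
Qed.

Section Tail.
Variables (N : lmodType R) (X : proj_resolution N).

Lemma res_aug_d x : res_aug X (res_d X 0 x) = 0.
Proof. by apply: (@res_exact0 _ _ X _).2; exists x. Qed.

Definition tail_aug : {linear X 1%N -> ker (res_aug X)} := ker_lift res_aug_d.

Lemma tail_aug_surj : surj tail_aug.
Proof.
move=> u; have [x xE] := (res_exact0 (ker_incl _ u)).1 (ker_inclP u).
by exists x; apply: ker_incl_inj; rewrite ker_liftE.
Qed.

Lemma tail_exact0 : exact_at (res_d X 1) tail_aug.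
Proof.
move=> y; rewrite -(@res_exact _ _ X 0 y); split=> [y0|y0].
  by rewrite -(ker_liftE res_aug_d) y0 linear0.
by apply: ker_incl_inj; rewrite linear0 ker_liftE.
Qed.

(** Dropping the first term resolves the first syzygy, which shifts dimension:
    Ext in degree i+2 becomes Ext in degree i+1. *)
Definition tail_resolution : proj_resolution (ker (res_aug X)) :=
  @ProjResolution R _ (fun i => X i.+1) (fun i => res_d X i.+1) tail_aug
    (fun i => @res_projective _ _ X i.+1) tail_aug_surj tail_exact0
    (fun i => @res_exact _ _ X i.+1).

(** In degree one, acyclicity does not involve the rest of the resolution: a
    cocycle on X 1 is a map on the first syzygy. *)
Lemma acyclic1_extension L : hom_acyclic_at L X 1 <->
  forall f : {linear ker (res_aug X) -> L},
    exists g : {linear X 0%N -> L}, forall u, f u = g (ker_incl _ u).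
Proof.
split=> [X1 f|ext f fd0].
  have [x|g gE] := X1 (f \o tail_aug).
    rewrite -[RHS](linear0 f); congr (f _); apply/tail_exact0.
    by exists x.
  by exists g => u; have [x <-] := tail_aug_surj u; rewrite [LHS]gE.
have f0 x : tail_aug x = 0 -> f x = 0 by move=> /tail_exact0[y <-].
have [s sK] := surj_section tail_aug_surj.
have sE x : f (s (tail_aug x)) = f x.
  by apply/eqP; rewrite -subr_eq0 -linearB f0 // linearB sK subrr.
have fs_lin : linear (fun u => f (s u)).
  by move=> r u v; rewrite -(sK u) -(sK v) -linearP !sE linearP.
have [g gE] := ext (mk_linear fs_lin); exists g => x.
by rewrite -(ker_liftE res_aug_d) -gE /= sE.
Qed.

End Tail.

(** Dimension shifting reduces to degree one.  There, a map f on the syzygy of T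
    gives the map f b1 on that of T', which extends to some g; then g a0
    extends f up to the term f h, which is itself defined on X 0. *)
Lemma acyclic_stable_retract L i T T' (X : proj_resolution T)
    (X' : proj_resolution T') : stable_retract T T' ->
  hom_acyclic_at L X' i.+1 -> hom_acyclic_at L X i.+1.
Proof.
elim: i T T' X X' => [|i IHi] T T' X X' TT'; last first.
  apply: (IHi _ _ (tail_resolution X) (tail_resolution X')).
  apply: stable_retract_ker TT'; try exact: res_projective; exact: res_aug_surj.
rewrite !acyclic1_extension => ext f.
have [a0 [a1 [b1 [h [a1E abE]]]]] := syzygy_comparison (@res_projective _ _ X 0)
  (@res_projective _ _ X' 0) (@res_aug_surj _ _ X) (@res_aug_surj _ _ X') TT'.
have [g gE] := ext (f \o b1); exists ((g \o a0) \- (f \o h)) => u /=.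
by rewrite -a1E -gE /= abE linearD addrK.
Qed.

Lemma Ext_stable_retract L i T T' : (0 < i)%N ->
  stable_retract T T' -> Ext_vanishes i T' L -> Ext_vanishes i T L.
Proof.
case: i => // i _ TT' [X' X'i]; have [X] := resolution_exists T.
exists X; exact: acyclic_stable_retract TT' X'i.
Qed.

End StableRetract.

(** * Retracts of torsionfree modules *)

Lemma coker_map_exists (R : pzRingType) (M N M' N' : lmodType R)
    (f : {linear M -> N}) (f' : {linear M' -> N'})
    (a : {linear M -> M'}) (b : {linear N -> N'}) :
  (forall x, b (f x) = f' (a x)) ->
  exists c : {linear coker f -> coker f'},
    forall y, c (coker_proj f y) = coker_proj f' (b y).
Proof.
move=> bf; apply: (@coker_factor _ _ _ f _ (coker_proj f' \o b)) => x /=.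
by apply/coker_proj_exact; exists (a x); rewrite bf.
Qed.

Section Retract.
Variable R : pzRingType.
Implicit Types M N L P : lmodType R.

Definition retract M N : Prop :=
  exists (s : {linear M -> N}) (r : {linear N -> M}), cancel s r.

Lemma finitely_generated_retract M N :
  retract M N -> finitely_generated N -> finitely_generated M.
Proof.
case=> s [r sK]; apply: (@finitely_generated_surj _ _ _ r) => x.
by exists (s x); exact: sK.
Qed.

Lemma dual_mapE M N (f : {linear M -> N}) (g : dual N) x :
  dual_map f g x = g (f x).
Proof. by []. Qed.

(** Maps of modules lift to presentations and dualize to maps of transposes, in
    the opposite direction.  The composite of the lifts on P0 is homotopic to 1
    through h : P0 -> P1, so on P1 it is 1 + h f + t with f t = 0.  In the
    transpose the dual of h f vanishes, and the dual of t kills the image of the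
    dual of f, so that it factors through the projective module dual P1. *)
Lemma transpose_stable_retract M M' (P1 P0 P1' P0' : lmodType R)
    (f : {linear P1 -> P0}) (p : {linear P0 -> M})
    (f' : {linear P1' -> P0'}) (p' : {linear P0' -> M'}) :
  fg_proj_presentation f p -> fg_proj_presentation f' p' -> retract M M' ->
  stable_retract (coker (dual_map f)) (coker (dual_map f')).
Proof.
move=> [[P1fg P1p] [_ P0p] pS fp] [[_ P1p'] [_ P0p'] pS' fp'] [s [r sK]].
have pf x : p (f x) = 0 by apply/fp; exists x.
have pf' x : p' (f' x) = 0 by apply/fp'; exists x.
have [s0 s0E] := P0p _ _ p' (s \o p) pS'.
have [r0 r0E] := P0p' _ _ p (r \o p') pS.
have [x|s1 s1E] := projective_lift_exact (f := s0 \o f) P1p fp'.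
  by rewrite /= s0E /= pf linear0.
have [x|r1 r1E] := projective_lift_exact (f := r0 \o f') P1p' fp.
  by rewrite /= r0E /= pf' linear0.
have [x|h hE] := projective_lift_exact (f := (r0 \o s0) \- idfun) P0p fp.
  by rewrite linearB r0E /= s0E /= sK subrr.
have [g|a aE] := @coker_map_exists _ _ _ _ _ (dual_map f) (dual_map f')
    (dual_map r0) (dual_map r1).
  by apply: hom_ext => x; rewrite !dual_mapE r1E.
have [g|b bE] := @coker_map_exists _ _ _ _ _ (dual_map f') (dual_map f)
    (dual_map s0) (dual_map s1).
  by apply: hom_ext => x; rewrite !dual_mapE s1E.
pose t : {linear P1 -> P1} := ((r1 \o s1) \- idfun) \- (h \o f).
have ft x : f (t x) = 0.
  rewrite !linearB /= r1E /= s1E hE /=; exact: subrr.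
have [g|k kE] := @coker_factor _ _ _ (dual_map f) _ (dual_map t).
  by apply: hom_ext => x; rewrite !dual_mapE ft linear0.
exists (dual P1), a, b, k, (coker_proj (dual_map f)).
split; first exact: projective_dual.
move=> u; have [g <-] := coker_proj_surj u; rewrite aE bE kE -linearD.
apply/eqP; rewrite -subr_eq0 -linearB; apply/eqP/coker_proj_exact.
exists (dual_map h g); apply: hom_ext => x.
have -> : (dual_map s1 (dual_map r1 g) - (g + dual_map t g)) x =
    g (r1 (s1 x)) - (g x + g (t x)) by [].
rewrite !dual_mapE -linearD -linearB; congr (g _); rewrite /t /=.
by rewrite addrA [x + _]addrC subrK subKr.
Qed.

(** The relations of M are those of M' together with the image of a lift e to P0
    of the complementary idempotent 1 - s r. *)
Lemma retract_presentation M M' (P1 P0 : lmodType R) (f : {linear P1 -> P0})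
    (p : {linear P0 -> M'}) : fg_proj_presentation f p -> retract M M' ->
  exists (Q1 : lmodType R) (g : {linear Q1 -> P0}) (q : {linear P0 -> M}),
    fg_proj_presentation g q.
Proof.
move=> [[P1fg P1p] [P0fg P0p] pS fp] [s [r sK]].
have [e eE] := P0p _ _ p ((idfun \- (s \o r)) \o p) pS.
exists (P1 * P0)%type, (copair f e), (r \o p).
have q0 x : r (p (e x)) = 0 by rewrite eE /= linearB sK subrr.
split=> [|//|y|y /=].
- by split; [exact: finitely_generated_prod|exact: projective_prod].
- by have [x xE] := pS (s y); exists x; rewrite /= xE sK.
- split=> [ry0|[[x x'] <-]]; last first.
    rewrite /= !linearD q0 addr0 (_ : p (f x) = 0) ?linear0 //.
    by apply/fp; exists x.
  have /fp[x xE] : p (y - e y) = 0.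
    by rewrite linearB eE /= ry0 linear0 subr0 subrr.
  by exists (x, y); rewrite /= xE subrK.
Qed.

Lemma TF_retract n M M' : retract M M' -> TF n M' -> TF n M.
Proof.
move=> MM' [M'fg [P1 [P0 [f [p [pres ext]]]]]].
split; first exact: finitely_generated_retract MM' M'fg.
have [Q1 [g [q pres']]] := retract_presentation pres MM'.
exists Q1, P0, g, q; split=> // i /andP[i0 iltn].
apply: Ext_stable_retract (ext i _) => //; last by rewrite i0.
exact: transpose_stable_retract pres' pres MM'.
Qed.

End Retract.

(** * Functors preserving torsionfree modules *)

Record exact_functor (R S : pzRingType) := ExactFunctor {
  fobj :> lmodType R -> lmodType S;
  fmap : forall M N : lmodType R, {linear M -> N} -> {linear fobj M -> fobj N};
  fmap_exact : forall (M N L : lmodType R) (f : {linear M -> N})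
    (g : {linear N -> L}), exact_at f g -> exact_at (fmap f) (fmap g);
  fmap_surj : forall (M N : lmodType R) (f : {linear M -> N}),
    surj f -> surj (fmap f);
  fobj_projective : forall P, projective P -> projective (fobj P)
}.

(** This is acyclicity of a resolution in a positive degree, with values in R,
    isolated from the resolution. *)
Definition dual_exact (R : pzRingType) (X Y Z : lmodType R)
    (d : {linear X -> Y}) (d' : {linear Y -> Z}) : Prop :=
  forall f : {linear Y -> R^o}, (forall x, f (d x) = 0) ->
    exists g : {linear Z -> R^o}, forall y, f y = g (d' y).

Section TransferFunctor.
Variables (R S : pzRingType) (F : exact_functor R S).

Definition preserves_dual_exact : Prop :=
  forall (X Y Z : lmodType R) (d : {linear X -> Y}) (d' : {linear Y -> Z}),
    dual_exact d d' -> dual_exact (fmap F d) (fmap F d').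

Definition preserves_fg : Prop :=
  forall M, finitely_generated M -> finitely_generated (F M).

Lemma Ext_functor i N : preserves_dual_exact -> (0 < i)%N ->
  Ext_vanishes i N R^o -> Ext_vanishes i (F N) S^o.
Proof.
case: i => // i Fd _ [X Xi].
pose FX := @ProjResolution S (F N) (fun j => F (X j))
  (fun j => fmap F (res_d X j)) (fmap F (res_aug X))
  (fun j => @fobj_projective _ _ F _ (@res_projective _ _ X j))
  (@fmap_surj _ _ F _ _ _ (@res_aug_surj _ _ X))
  (@fmap_exact _ _ F _ _ _ _ _ (@res_exact0 _ _ X))
  (fun j => @fmap_exact _ _ F _ _ _ _ _ (@res_exact _ _ X j)).
by exists FX; exact: (Fd _ _ _ _ _ Xi).
Qed.

End TransferFunctor.

(** When the duals of F P and P correspond under G, the transpose of F M is G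
    of the transpose of M, and Ext computed on one side controls the other. *)
Lemma TF_functor (R S : pzRingType) (F : exact_functor R S)
    (G : exact_functor R^c S^c)
    (tau : forall P : lmodType R, {linear dual (F P) -> G (dual P)}) n M :
  preserves_fg F -> preserves_dual_exact G ->
  (forall P, bijective (tau P)) ->
  (forall (P Q : lmodType R) (f : {linear P -> Q}) g,
     tau P (dual_map (fmap F f) g) = fmap G (dual_map f) (tau Q g)) ->
  TF n M -> TF n (F M).
Proof.
move=> Ffg Gd tauB tauN [Mfg [P1 [P0 [f [p [[P1P P0P pS fp] ext]]]]]].
split; first exact: Ffg.
exists (F P1), (F P0), (fmap F f), (fmap F p); split.
  case: P1P P0P => P1fg P1p [P0fg P0p]; split.
  - by split; [exact: Ffg|exact: fobj_projective].
  - by split; [exact: Ffg|exact: fobj_projective].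
  - exact: fmap_surj.
  - exact: fmap_exact.
move=> i /[dup] /ext Exti /andP[i0 _].
apply: Ext_stable_retract (Ext_functor Gd i0 Exti) => //.
apply/stable_retract_iso.
pose v : {linear dual (F P1) -> G (coker (dual_map f))} :=
  fmap G (coker_proj (dual_map f)) \o tau P1.
apply: (@coker_iso _ _ _ _ _ v) => [z|y].
  have [x <-] := @fmap_surj _ _ G _ _ (coker_proj _) (@coker_proj_surj _ _ _ _) z.
  by have [y <-] := bij_surj (tauB P1) x; exists y.
have Gex := @fmap_exact _ _ G _ _ _ _ _ (@coker_proj_exact _ _ _ (dual_map f)).
split=> [/Gex[x xE]|[x <-]].
  have [z zE] := bij_surj (tauB P0) x; exists z.
  by apply: (bij_inj (tauB P1)); rewrite tauN zE xE.
by apply/Gex; exists (tau P0 x); rewrite tauN.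
Qed.

(** * Frobenius extensions *)

(** Right modules are left modules over converse rings, so statements on the
    right are statements along the converse of phi. *)

Section Converse.
Variables (R A : pzRingType) (phi : {rmorphism R -> A}).

Definition conv_fun : R^c -> A^c := phi.

Lemma conv_fun_additive : nmod_morphism conv_fun.
Proof. by split=> [|x y]; [exact: (rmorph0 phi)|exact: (rmorphD phi)]. Qed.
Lemma conv_fun_monoid : monoid_morphism conv_fun.
Proof. by split=> [|x y]; [exact: (rmorph1 phi)|exact: (rmorphM phi)]. Qed.
HB.instance Definition _ :=
  Algebra.isNmodMorphism.Build R^c A^c conv_fun conv_fun_additive.
HB.instance Definition _ :=
  GRing.isMonoidMorphism.Build R^c A^c conv_fun conv_fun_monoid.

Definition conv_morphism : {rmorphism R^c -> A^c} := conv_fun.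

End Converse.

(** A Frobenius form, that is, an R-bilinear map E : A -> R, together with dual
    bases for the pairing E(ab).  In contrast with an isomorphism between A and
    Hom_R(A, R), these data treat left and right alike. *)
Record frobenius_system (R A : pzRingType) (phi : {rmorphism R -> A}) :=
  FrobeniusSystem {
    frob_form :> A -> R;
    frob_size : nat;
    frob_x : 'I_frob_size -> A;
    frob_y : 'I_frob_size -> A;
    frobD : forall a b, frob_form (a + b) = frob_form a + frob_form b;
    frobZl : forall r a, frob_form (phi r * a) = r * frob_form a;
    frobZr : forall r a, frob_form (a * phi r) = frob_form a * r;
    frob_xE : forall a, \sum_i phi (frob_form (a * frob_y i)) * frob_x i = a;
    frob_yE : forall a, \sum_i frob_y i * phi (frob_form (frob_x i * a)) = a
  }.

Definition frobenius_conv (R A : pzRingType) (phi : {rmorphism R -> A})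
    (E : frobenius_system phi) : frobenius_system (conv_morphism phi) :=
  @FrobeniusSystem R^c A^c (conv_morphism phi) E (frob_size E) (@frob_y _ _ _ E)
    (@frob_x _ _ _ E) (@frobD _ _ _ E) (fun r a => frobZr E r a)
    (fun r a => frobZl E r a) (@frob_yE _ _ _ E) (@frob_xE _ _ _ E).

(** The form is the image of 1 under the isomorphism f from A to Hom_R(A, R), so
    that f(a) is E(- a).  The coordinate functions of a dual basis x of A are
    then E(- y_i), which is the first dual basis identity; the second one holds
    after applying all E(z -), and those separate points since f is
    injective. *)
Lemma frobenius_system_exists (R A : pzRingType) (phi : {rmorphism R -> A}) :
  frobenius phi -> inhabited (frobenius_system phi).
Proof.
case=> Afg Ap [f [fR fB]].
pose e : {linear restr phi A^o -> R^o} := f (1 : A); pose E (a : A) : R := e a.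
have fE (a x : A) : (f a : hom _ _) x = E (x * a).
  have -> : f a = a *: f (1 : A).
    by rewrite -linearZ; congr (f _); exact/esym/mulr1.
  by [].
have ED a b : E (a + b) = E a + E b by exact: linearD.
have EZl r a : E (phi r * a) = r * E a.
  by rewrite /E -[phi r * a]/(r *: (a : restr phi A^o)) linearZ.
have EZr r a : E (a * phi r) = E a * r.
  rewrite -fE; have := fR (1 : A) r.
  by rewrite -[ract _ _]/(1 * phi r : A) mul1r => ->.
have [n [x [c cE]]] := dual_basis Afg Ap.
have yP i : exists z : A, forall a, c i a = E (a * z).
  by have [z zc] := bij_surj fB (c i); exists z => a; rewrite -fE zc.
have [y yE] := choice yP.
have Ex a : \sum_i phi (E (a * y i)) * x i = a.
  by rewrite [RHS]cE; apply: eq_bigr => i _; rewrite yE.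
have Einj a b : (forall z, E (z * a) = E (z * b)) -> a = b.
  by move=> ab; apply: (bij_inj fB); apply: hom_ext => z; rewrite !fE.
have E0 : E 0 = 0 by apply: (addrI (E 0)); rewrite -ED !addr0.
have Esum I (r : seq I) (F : I -> A) : E (\sum_(i <- r) F i) = \sum_(i <- r) E (F i).
  exact: (big_morph E ED E0).
constructor; apply: (FrobeniusSystem ED EZl EZr Ex) => a.
apply: Einj => z; rewrite -[in RHS](Ex z) mulr_sumr mulr_suml !Esum.
by apply: eq_bigr => i _; rewrite mulrA EZr -mulrA EZl.
Qed.

Section FrobeniusForm.
Variables (R A : pzRingType) (phi : {rmorphism R -> A}).
Variable E : frobenius_system phi.
Local Notation x_ i := (@frob_x _ _ _ E i).
Local Notation y_ i := (@frob_y _ _ _ E i).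

Lemma frob0 : E 0 = 0.
Proof. by apply: (addrI (E 0)); rewrite -frobD !addr0. Qed.

Lemma frob_sum I (r : seq I) (F : I -> A) :
  E (\sum_(i <- r) F i) = \sum_(i <- r) E (F i).
Proof. exact: (big_morph E (frobD E) frob0). Qed.

Lemma frob_form_linear :
  linear ((E : A -> R) : restr phi A^o -> R^o).
Proof.
move=> r a b; rewrite -[r *: a]/(phi r * (a : A)).
exact: etrans (frobD E _ _) (congr1 (+%R^~ _) (frobZl E _ _)).
Qed.

Lemma restr_regular_projective : projective (restr phi A^o).
Proof.
have c_lin i : linear ((fun a : A => E (a * y_ i)) : restr phi A^o -> R^o).
  move=> r a b; rewrite -[r *: a]/(phi r * (a : A)).
  by rewrite mulrDl frobD -mulrA frobZl.
apply: (@dual_basis_projective _ (restr phi A^o) _ (fun i => x_ i)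
  (fun i => mk_linear (c_lin i))) => a.
exact/esym/(frob_xE E).
Qed.

End FrobeniusForm.

(** * Restriction and coinduction along a Frobenius extension *)

Section Coinduction.
Variables (R A : pzRingType) (phi : {rmorphism R -> A}).

(** Coinduction Hom_R(A, M); over a Frobenius extension it stands for the
    induced module, with which it is naturally isomorphic. *)
Definition coind (M : lmodType R) : Type := hom (restr phi A^o) M.

Section CoindModule.
Variable M : lmodType R.

HB.instance Definition _ := GRing.Zmodule.copy (coind M) (hom (restr phi A^o) M).

Lemma coind_scale_subproof (a : A) (f : coind M) :
  linear ((fun x : A => f (x * a)) : restr phi A^o -> M).
Proof.
move=> r x y; rewrite -linearP; congr (f _).
by rewrite -[r *: x]/(phi r * (x : A)) mulrDl -mulrA.
Qed.
Definition coind_scale a f : coind M := mk_linear (@coind_scale_subproof a f).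

Lemma coind_scaleA a b f : coind_scale a (coind_scale b f) = coind_scale (a * b) f.
Proof. by apply: hom_ext => x /=; rewrite mulrA. Qed.
Lemma coind_scale1 : left_id 1 coind_scale.
Proof. by move=> f; apply: hom_ext => x /=; rewrite mulr1. Qed.
Lemma coind_scaleDr : right_distributive coind_scale +%R.
Proof. by move=> a f g; apply: hom_ext. Qed.
Lemma coind_scaleDl f : {morph coind_scale^~ f : a b / a + b}.
Proof. by move=> a b; apply: hom_ext => x /=; rewrite mulrDr linearD. Qed.

HB.instance Definition _ := GRing.Zmodule_isLmodule.Build A (coind M)
  coind_scaleA coind_scale1 coind_scaleDr coind_scaleDl.

Lemma coindZ a (f : coind M) (x : A) : (a *: f) x = f (x * a).
Proof. by []. Qed.

Lemma coindD (f g : coind M) (x : A) : (f + g) x = f x + g x.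
Proof. by []. Qed.

Lemma coind_sumE (J : Type) (r : seq J) (F : J -> coind M) (x : A) :
  (\sum_(j <- r) F j) x = \sum_(j <- r) F j x.
Proof. exact: hom_sumE. Qed.

Lemma coind_restrZ r (f : coind M) (x : A) : f (phi r * x) = r *: f x.
Proof. exact: linearZ. Qed.

End CoindModule.

Lemma coind_map_subproof (M N : lmodType R) (f : {linear M -> N}) :
  linear (fun g : coind M => f \o g : coind N).
Proof. by move=> a g h; apply: hom_ext => x /=; rewrite linearD. Qed.
Definition coind_map (M N : lmodType R) (f : {linear M -> N}) :
  {linear coind M -> coind N} := mk_linear (coind_map_subproof f).

Lemma coind_mapE (M N : lmodType R) (f : {linear M -> N}) (g : coind M) x :
  coind_map f g x = f (g x).
Proof. by []. Qed.

Lemma restr_map_subproof (M N : lmodType A) (f : {linear M -> N}) :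
  linear (f : restr phi M -> restr phi N).
Proof. by move=> r x y; exact: linearP. Qed.
Definition restr_map (M N : lmodType A) (f : {linear M -> N}) :
  {linear restr phi M -> restr phi N} := mk_linear (restr_map_subproof f).

(** Coinduction is right adjoint to restriction. *)
Section CoindAdjunct.
Variables (N : lmodType A) (M : lmodType R) (g : {linear restr phi N -> M}).

Lemma coind_adjunct_subproof1 (n : N) :
  linear ((fun a : A => g (a *: n)) : restr phi A^o -> M).
Proof.
move=> r a b; rewrite -linearP; congr (g _).
by rewrite -[r *: a]/(phi r * (a : A)) scalerDl -scalerA.
Qed.
Lemma coind_adjunct_subproof2 :
  linear (fun n => mk_linear (coind_adjunct_subproof1 n) : coind M).
Proof.
move=> a n n'; apply: hom_ext => b /=; rewrite -linearD; congr (g _).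
by rewrite scalerDr scalerA.
Qed.
Definition coind_adjunct : {linear N -> coind M} :=
  mk_linear coind_adjunct_subproof2.

Lemma coind_adjunctE n (a : A) : coind_adjunct n a = g (a *: n).
Proof. by []. Qed.

End CoindAdjunct.

Hypothesis A_projective : projective (restr phi A^o).

Lemma coind_surj (M N : lmodType R) (f : {linear M -> N}) :
  surj f -> surj (coind_map f).
Proof.
move=> fS g; have [h hE] := A_projective (g : {linear _ -> _}) fS.
by exists (h : coind M); apply: hom_ext.
Qed.

Lemma coind_exact (M N L : lmodType R) (f : {linear M -> N})
    (g : {linear N -> L}) :
  exact_at f g -> exact_at (coind_map f) (coind_map g).
Proof.
move=> fg h; split=> [gh0|[k <-]]; last first.
  by apply: hom_ext => x; apply/fg; exists (k x).
have [x|k kE] := projective_lift_exact (f := h : {linear _ -> _}) A_projective fg.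
  by rewrite -[LHS]/(coind_map g h x) gh0.
by exists (k : coind M); apply: hom_ext.
Qed.

(** Restriction preserves projectives because its right adjoint preserves
    surjections. *)
Lemma restr_projective (P : lmodType A) : projective P -> projective (restr phi P).
Proof.
move=> Pp M N p g pS.
have [h hE] := Pp _ _ (coind_map p) (coind_adjunct g) (coind_surj pS).
have h1_lin : linear ((fun x : P => h x (1 : A)) : restr phi P -> M).
  move=> r x y; rewrite -[r *: x]/(phi r *: (x : P)) linearP coindD coindZ.
  by rewrite mul1r -[X in h x X]mulr1 coind_restrZ.
exists (mk_linear h1_lin) => x.
by rewrite -[LHS]/(coind_map p (h x) (1 : A)) hE coind_adjunctE scale1r.
Qed.

End Coinduction.

Section FrobeniusFunctors.
Variables (R A : pzRingType) (phi : {rmorphism R -> A}).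
Variable E : frobenius_system phi.
Local Notation x_ i := (@frob_x _ _ _ E i).
Local Notation y_ i := (@frob_y _ _ _ E i).

(** Coinduction is left adjoint to restriction as well: the unit sends m to
    E(-) m, and an R-linear map h from M to N extends along the unit by the
    dual bases. *)
Section Unit.
Variable M : lmodType R.

Lemma coind_unit_subproof1 (m : M) :
  linear ((fun a : A => E a *: m) : restr phi A^o -> M).
Proof.
move=> r a b; rewrite -[r *: a]/(phi r * (a : A)).
by rewrite frobD frobZl scalerDl scalerA.
Qed.
Lemma coind_unit_subproof2 :
  linear (fun m => mk_linear (coind_unit_subproof1 m) : restr phi (coind phi M)).
Proof.
move=> r m m'; apply: hom_ext => a /=; rewrite scalerDr scalerA.
by rewrite -[X in _ = X + _]/(E (a * phi r) *: m) frobZr.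
Qed.
Definition coind_unit : {linear M -> restr phi (coind phi M)} :=
  mk_linear coind_unit_subproof2.

Lemma coind_unitE m (a : A) : (coind_unit m : coind phi M) a = E a *: m.
Proof. by []. Qed.

Lemma coind_unit_expand (f : coind phi M) :
  f = \sum_i y_ i *: (coind_unit (f (x_ i)) : coind phi M).
Proof.
apply: hom_ext => a; rewrite coind_sumE -{1}[a : A](frob_xE E) linear_sum.
by apply: eq_bigr => i _; rewrite coind_restrZ.
Qed.

Variables (N : lmodType A) (h : {linear M -> restr phi N}).

Let hZ r m : h (r *: m) = phi r *: (h m : N).
Proof. exact: (linearZ_LR h). Qed.

Lemma coind_extend_subproof :
  linear (fun f : coind phi M => \sum_i y_ i *: (h (f (x_ i)) : N)).
Proof.
move=> a f g; rewrite scaler_sumr.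
under eq_bigr => i do rewrite coindD linearD scalerDr.
rewrite big_split; congr (_ + _).
(* Expanding x_i a in the basis x, then summing over i, moves a across to the
   left of y_j. *)
transitivity (\sum_i \sum_j (y_ i * phi (E (x_ i * a * y_ j))) *: (h (f (x_ j)) : N)).
  apply: eq_bigr => i _; rewrite coindZ -{1}[x_ i * a](frob_xE E) !linear_sum.
  by rewrite scaler_sumr; apply: eq_bigr => j _; rewrite coind_restrZ hZ scalerA.
rewrite exchange_big; apply: eq_bigr => j _; rewrite -scaler_suml scalerA.
rewrite -[in RHS](frob_yE E (a * y_ j)).
by congr (_ *: _); apply: eq_bigr => i _; rewrite mulrA.
Qed.
Definition coind_extend : {linear coind phi M -> N} :=
  mk_linear coind_extend_subproof.

Lemma coind_extendE f : coind_extend f = \sum_i y_ i *: (h (f (x_ i)) : N).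
Proof. by []. Qed.

Lemma coind_extend_unit m : coind_extend (coind_unit m) = h m.
Proof.
rewrite coind_extendE -[RHS](scale1r (h m : N)) -(frob_yE E 1) scaler_suml.
by apply: eq_bigr => i _; rewrite coind_unitE hZ scalerA mulr1.
Qed.

End Unit.

Lemma coind_unit_natural (M N : lmodType R) (f : {linear M -> N}) m :
  coind_map phi f (coind_unit M m) = coind_unit N (f m).
Proof. by apply: hom_ext => a; rewrite coind_mapE !coind_unitE linearZ. Qed.

Lemma coind_hom_expand (M : lmodType R) (N : lmodType A)
    (g : {linear coind phi M -> N}) f :
  g f = \sum_i y_ i *: g (coind_unit M (f (x_ i))).
Proof.
rewrite {1}[f]coind_unit_expand linear_sum; apply: eq_bigr => i _.
by rewrite linearZ.
Qed.

Let A_projective := restr_regular_projective E.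

(** The left adjunction: a lift over R along the restricted surjection extends
    to a lift over A. *)
Lemma coind_projective (P : lmodType R) :
  projective P -> projective (coind phi P).
Proof.
move=> Pp M N p g pS.
have [h hE] := Pp _ _ (restr_map phi p) (restr_map phi g \o coind_unit P) pS.
exists (coind_extend h) => f; rewrite coind_extendE linear_sum [RHS]coind_hom_expand.
by apply: eq_bigr => i _; rewrite linearZ; congr (_ *: _); exact: hE.
Qed.

Definition coind_functor : exact_functor R A :=
  @ExactFunctor R A (coind phi) (coind_map phi)
    (coind_exact A_projective) (coind_surj A_projective) coind_projective.

Definition restr_functor : exact_functor A R :=
  @ExactFunctor A R (restr phi) (restr_map phi)
    (fun M N L f g fg => fg) (fun M N f fS => fS) (restr_projective A_projective).

Lemma coind_fg : preserves_fg coind_functor.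
Proof.
move=> M [n [v vP]]; exists n, (fun j => coind_unit M (v j)) => f.
have [c cE] := choice (fun i => vP (f (x_ i))).
exists (fun j => \sum_i y_ i * phi (c i j)).
rewrite {1}[f]coind_unit_expand.
under [RHS]eq_bigr => j do rewrite scaler_suml.
rewrite exchange_big; apply: eq_bigr => i _; rewrite {1}cE linear_sum scaler_sumr.
apply: eq_bigr => j _; rewrite -scalerA; congr (_ *: _).
exact: (linearZ_LR (coind_unit M)).
Qed.

Lemma restr_fg : preserves_fg restr_functor.
Proof.
move=> N [n [v vP]].
apply: (@finitely_generated_finType _ _ _
  (fun ij : 'I_(frob_size E) * 'I_n => x_ ij.1 *: v ij.2 : restr phi N)) => w.
have [c cE] := vP w; exists (fun ij => E (c ij.2 * y_ ij.1)).
rewrite -(pair_bigA _ (fun i j => E (c j * y_ i) *: (x_ i *: v j : restr phi N))).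
rewrite exchange_big {1}cE; apply: eq_bigr => j _.
rewrite -{1}(frob_xE E (c j)) scaler_suml; apply: eq_bigr => i _.
by rewrite -scalerA.
Qed.

(** Composition with E identifies Hom_A(N, A) with Hom_R(N, R). *)
Section RestrDual.
Variable N : lmodType A.

Lemma morphism_is_linear : linear (phi : R^o -> restr phi A^o).
Proof. by move=> r a b; rewrite rmorphD rmorphM. Qed.

Definition frob_lift (h : {linear restr phi N -> R^o}) : {linear N -> A^o} :=
  coind_extend (mk_linear morphism_is_linear) \o coind_adjunct h.

Lemma frob_liftE (h : {linear restr phi N -> R^o}) n :
  frob_lift h n = \sum_i y_ i * phi (h (x_ i *: n)).
Proof. by []. Qed.

Definition frob_comp (g : {linear N -> A^o}) : {linear restr phi N -> R^o} :=
  mk_linear (frob_form_linear E) \o restr_map phi g.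

Lemma frob_compE (g : {linear N -> A^o}) n : frob_comp g n = E (g n).
Proof. by []. Qed.

Lemma frob_liftK h n : E (frob_lift h n) = h n.
Proof.
rewrite frob_liftE frob_sum -[in RHS](scale1r n) -(frob_xE E 1) scaler_suml.
rewrite linear_sum; apply: eq_bigr => i _; rewrite frobZr mul1r -scalerA.
exact/esym/(linearZ_LR h).
Qed.

Lemma frob_compK g n : frob_lift (frob_comp g) n = g n.
Proof.
rewrite frob_liftE -[RHS](frob_yE E); apply: eq_bigr => i _.
by rewrite frob_compE linearZ.
Qed.

End RestrDual.

(** By adjunction, a cocycle with values in R is the same as one with values
    in A. *)
Lemma restr_dual_exact : preserves_dual_exact restr_functor.
Proof.
move=> X Y Z d d' dd' f fd0.
have [x|g gE] := dd' (frob_lift f).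
  by rewrite frob_liftE big1 // => i _; rewrite -linearZ fd0 rmorph0 mulr0.
by exists (frob_comp g) => y; rewrite -(frob_liftK f) gE.
Qed.

(** A cocycle f is determined by its values on the unit, whose coordinates in
    the basis x are cocycles on Y with values in R; these are coboundaries, and
    the maps g_j bounding them reassemble to a map bounding f. *)
Lemma coind_dual_exact : preserves_dual_exact coind_functor.
Proof.
move=> X Y Z d d' dd' f fd0.
have k_lin j : linear ((fun y => E ((f (coind_unit Y y) : A) * y_ j)) : Y -> R^o).
  move=> r y y'; rewrite linearD (_ : coind_unit Y (r *: y) =
    phi r *: (coind_unit Y y : coind phi Y) :> coind phi Y); last first.
    exact: (linearZ_LR (coind_unit Y)).
  by rewrite linearP mulrDl frobD -mulrA frobZl.
have gP j : exists g : {linear Z -> R^o},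
    forall y, E ((f (coind_unit Y y) : A) * y_ j) = g (d' y).
  have [x|g gE] := dd' (mk_linear (k_lin j)); last by exists g.
  rewrite -[LHS]/(E ((f (coind_unit Y (d x)) : A) * y_ j)) -coind_unit_natural.
  by rewrite fd0 mul0r frob0.
have [g gE] := choice gP.
have h_lin : linear ((fun z => \sum_j phi (g j z) * x_ j) : Z -> restr phi A^o).
  move=> r z z'; rewrite -[X in _ = X + _]/(phi r * _) mulr_sumr -big_split.
  by apply: eq_bigr => j _; rewrite linearP rmorphD rmorphM mulrDl mulrA.
exists (coind_extend (mk_linear h_lin)) => y.
rewrite coind_extendE coind_hom_expand; apply: eq_bigr => i _; congr (_ *: _).
rewrite coind_mapE -[LHS](frob_xE E); apply: eq_bigr => j _.
by rewrite gE.
Qed.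

End FrobeniusFunctors.

(** * Transfer of torsionfreeness *)

Section TorsionfreeTransfer.
Variables (R A : pzRingType) (phi : {rmorphism R -> A}).
Variable E : frobenius_system phi.
Local Notation x_ i := (@frob_x _ _ _ E i).
Local Notation y_ i := (@frob_y _ _ _ E i).
Local Notation phic := (conv_morphism phi).
Local Notation Ec := (frobenius_conv E).

Section RestrDualIso.
Variable N : lmodType A.

Lemma dual_restr_subproof :
  linear (fun h : dual (restr phi N) =>
            frob_lift E h : restr phic (dual N)).
Proof.
move=> r h k; apply: hom_ext => n.
rewrite -[RHS]/(((frob_lift E h) n : A) * phi r + frob_lift E k n).
rewrite !frob_liftE mulr_suml -big_split; apply: eq_bigr => i _.
by rewrite -[_ (x_ i *: n)]/((h (x_ i *: n) : R) * r + k (x_ i *: n))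
  rmorphD rmorphM mulrDr mulrA.
Qed.
Definition dual_restr : {linear dual (restr phi N) -> restr phic (dual N)} :=
  mk_linear dual_restr_subproof.

Lemma dual_restr_bij : bijective dual_restr.
Proof.
exists (fun g : dual N => frob_comp E g : dual (restr phi N)) => h; apply: hom_ext.
  by move=> n; exact: (frob_liftK E h n).
by move=> n; exact: (frob_compK E h n).
Qed.

End RestrDualIso.

Lemma dual_restr_natural (M N : lmodType A) (f : {linear M -> N}) h :
  dual_restr M (dual_map (restr_map phi f) h) =
  restr_map phic (dual_map f) (dual_restr N h).
Proof.
apply: hom_ext => n.
rewrite -[RHS]/(frob_lift E h (f n)) -[LHS]/(frob_lift E _ n) !frob_liftE.
by apply: eq_bigr => i _; rewrite -linearZ.
Qed.

Lemma TF_restr n N : TF n N -> TF n (restr phi N).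
Proof.
apply: (TF_functor (F := restr_functor E) (G := restr_functor Ec)
  (tau := dual_restr)).
- exact: restr_fg.
- exact: restr_dual_exact.
- exact: dual_restr_bij.
- exact: dual_restr_natural.
Qed.

(** Dually to coind_extend, an A-linear map g on the coinduced module is given
    by the R-linear map g u on M, and that by its pairings E(g(u m) a). *)
Section CoindDualIso.
Variable M : lmodType R.
Local Notation u := (@coind_unit _ _ _ E M).

Lemma dual_coind_subproof1 (g : dual (coind phi M)) (a : A) :
  linear ((fun m => E ((g (u m) : A) * a)) : M -> R^o).
Proof.
move=> r m m'.
have -> : u (r *: m + m') = phi r *: (u m : coind phi M) + u m' :> coind phi M.
  exact: (linearP u).
by rewrite linearP mulrDl frobD -mulrA frobZl.
Qed.
Lemma dual_coind_subproof2 (g : dual (coind phi M)) :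
  linear ((fun a : A^c => mk_linear (dual_coind_subproof1 g a)) :
            restr phic (A^c)^o -> dual M).
Proof.
move=> r a b; apply: hom_ext => m.
rewrite -[LHS]/(E ((g (u m) : A) * ((a : A) * phi r + b))).
by rewrite mulrDr frobD mulrA frobZr.
Qed.
Lemma dual_coind_subproof3 :
  linear (fun g : dual (coind phi M) =>
            mk_linear (dual_coind_subproof2 g) : coind phic (dual M)).
Proof.
move=> b g h; apply: hom_ext => a; apply: hom_ext => m.
rewrite -[LHS]/(E (((g (u m) : A) * b + h (u m)) * a)).
by rewrite mulrDl frobD -mulrA.
Qed.
Definition dual_coind : {linear dual (coind phi M) -> coind phic (dual M)} :=
  mk_linear dual_coind_subproof3.

Lemma dual_coindE (g : dual (coind phi M)) (a : A) m :
  (dual_coind g a : dual M) m = E ((g (u m) : A) * a).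
Proof. by []. Qed.

Lemma dual_coind_bij : bijective dual_coind.
Proof.
apply: inj_surj_bij => [g h gh|F].
  apply: hom_ext => f; rewrite !(coind_hom_expand E).
  apply: eq_bigr => i _; congr (_ *: _).
  rewrite -[LHS](frob_xE E) -[RHS](frob_xE E); apply: eq_bigr => j _.
  by rewrite -!dual_coindE gh.
have FZ (a b : A) r m : (F (a * phi r + b) : dual M) m =
    ((F a : dual M) m : R) * r + (F b : dual M) m.
  have -> : F (a * phi r + b) = (r : R^c) *: (F a : dual M) + F b :> dual M.
    exact: (linearP (F : {linear restr phic (A^c)^o -> dual M}) r a b).
  by [].
have F0 m : (F (0 : A) : dual M) m = 0.
  apply: (addrI ((F (0 : A) : dual M) m)); rewrite addr0.
  by have := FZ 0 0 1 m; rewrite mul0r addr0 mulr1.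
have Fsum I (r : seq I) (G : I -> A) m :
    (F (\sum_(i <- r) G i) : dual M) m = \sum_(i <- r) ((F (G i) : dual M) m : R).
  apply: (big_morph (fun a : A => (F a : dual M) m : R)) => [a b|]; last exact: F0.
  by have := FZ a b 1 m; rewrite rmorph1 !mulr1.
have k_lin : linear ((fun m => \sum_i phi ((F (y_ i) : dual M) m) * x_ i) :
    M -> restr phi A^o).
  move=> r m m'; rewrite -[X in _ = X + _]/(phi r * _) mulr_sumr -big_split.
  by apply: eq_bigr => i _; rewrite linearP rmorphD rmorphM mulrDl mulrA.
(* With k(m) = sum_i phi(F(y_i)(m)) x_i, the pairing E(k(m) a) is the sum of the
   F(y_i)(m) E(x_i a), which is F(a)(m) by expanding a in the basis y. *)
exists (coind_extend E (mk_linear k_lin) : dual (coind phi M)).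
apply: hom_ext => a; apply: hom_ext => m.
rewrite dual_coindE coind_extend_unit -[in RHS](frob_yE E a) Fsum.
rewrite -[LHS]/(E ((\sum_i phi ((F (y_ i) : dual M) m) * x_ i) * (a : A))).
rewrite mulr_suml frob_sum; apply: eq_bigr => i _.
have := FZ (y_ i) 0 (E (x_ i * a)) m; rewrite addr0 F0 addr0 => ->.
by rewrite -mulrA frobZl.
Qed.

End CoindDualIso.

Lemma dual_coind_natural (M N : lmodType R) (f : {linear M -> N}) g :
  dual_coind M (dual_map (coind_map phi f) g) =
  coind_map phic (dual_map f) (dual_coind N g).
Proof.
apply: hom_ext => a; apply: hom_ext => m.
rewrite coind_mapE dual_mapE !dual_coindE dual_mapE.
by rewrite coind_unit_natural.
Qed.

Lemma TF_coind n M : TF n M -> TF n (coind phi M).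
Proof.
apply: (TF_functor (F := coind_functor E) (G := coind_functor Ec)
  (tau := dual_coind)).
- exact: coind_fg.
- exact: coind_dual_exact.
- exact: dual_coind_bij.
- exact: dual_coind_natural.
Qed.

End TorsionfreeTransfer.

(** * Decompositions into indecomposable modules *)

(** Direct sums are described internally, by inclusions and projections.  This
    allows any finite index type and any additive functor to act on them, with
    no transport between the summands of a product. *)
Record biproduct (R : pzRingType) (M : lmodType R) (I : finType)
    (X : I -> lmodType R) := Biproduct {
  binj : forall i, {linear X i -> M};
  bproj : forall i, {linear M -> X i};
  binjK : forall i, cancel (binj i) (bproj i);
  bproj0 : forall i j x, i != j -> bproj j (binj i x) = 0;
  bsum : forall x, \sum_i binj i (bproj i x) = x
}.

Section Biproduct.
Variable R : pzRingType.
Implicit Types M N : lmodType R.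

Lemma biproduct_dsum M (I : finType) (X : I -> lmodType R) :
  biproduct M X -> lmod_iso M (dsum (fun i : 'I_#|I| => X (enum_val i))).
Proof.
move=> B.
have f_lin : linear (fun x => (fun i => bproj B (enum_val i) x) :
    dsum (fun i : 'I_#|I| => X (enum_val i))).
  by move=> r x y; apply: functional_extensionality_dep => i; rewrite linearP.
exists (mk_linear f_lin).
exists (fun u : dsum _ => \sum_(i < #|I|) binj B (enum_val i) (u i)) => [x|u].
  rewrite -[RHS](bsum B x) [RHS](reindex (@enum_val I I)) //=.
  exact/onW_bij/enum_val_bij.
apply: functional_extensionality_dep => j /=.
rewrite linear_sum (bigD1 j) //= binjK big1 ?addr0 // => i ij.
by rewrite bproj0 // (inj_eq enum_val_inj).
Qed.

Lemma dsum_biproduct n (X : 'I_n -> lmodType R) : inhabited (biproduct (dsum X) X).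
Proof.
pose j i (x : X i) : dsum X := dfwith (fun k => 0 : X k) x.
have jK i x : j i x i = x by exact: dfwith_in.
have j0 i k x : i != k -> j i x k = 0 by move=> ik; exact: dfwith_out.
have j_lin i : linear (@j i).
  move=> r x y; apply: functional_extensionality_dep => k.
  rewrite -[RHS]/(r *: j i x k + j i y k).
  have [<-|ik] := eqVneq i k; first by rewrite !jK.
  by rewrite !j0 // scaler0 addr0.
have p_lin i : linear (fun u : dsum X => u i) by [].
constructor; apply: (@Biproduct _ (dsum X) _ X (fun i => mk_linear (@j_lin i))
  (fun i => mk_linear (p_lin i))) => [i x|i k x ik|u] /=.
- exact: jK.
- exact: j0.
- apply: functional_extensionality_dep => k; rewrite dsum_sumE (bigD1 k) //= jK.
  by rewrite big1 ?addr0 // => i /j0->.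
Qed.

Lemma biproduct_change M N (I : finType) (X Y : I -> lmodType R) :
  lmod_iso M N -> (forall i, lmod_iso (X i) (Y i)) ->
  inhabited (biproduct N X) -> inhabited (biproduct M Y).
Proof.
move=> [f /linear_inv[g [fK gK]]] XY [B].
have XYP i : exists h : {linear X i -> Y i} * {linear Y i -> X i},
    cancel h.1 h.2 /\ cancel h.2 h.1.
  by have [a /linear_inv[b abK]] := XY i; exists (a, b).
pose h i := projT1 (cid (XYP i)).
have hK i : cancel (h i).1 (h i).2 by rewrite /h; case: cid => /= ? [].
have hK' i : cancel (h i).2 (h i).1 by rewrite /h; case: cid => /= ? [].
constructor; apply: (@Biproduct _ M _ Y (fun i => g \o (binj B i \o (h i).2))
  (fun i => (h i).1 \o (bproj B i \o f))) => [i x|i k x ik|x] /=.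
- by rewrite gK binjK hK'.
- by rewrite gK bproj0 // linear0.
- rewrite -[RHS]fK -[f x in RHS](bsum B) linear_sum.
  by apply: eq_bigr => i _; rewrite hK.
Qed.

Lemma biproduct_sigma M (I : finType) (X : I -> lmodType R) (J : I -> finType)
    (Y : forall i, J i -> lmodType R) :
  biproduct M X -> (forall i, biproduct (X i) (Y i)) ->
  biproduct M (fun p : {i : I & J i} => Y (tag p) (tagged p)).
Proof.
move=> B C.
apply: (@Biproduct _ M _ (fun p : {i : I & J i} => Y (tag p) (tagged p))
  (fun p => binj B (tag p) \o binj (C (tag p)) (tagged p))
  (fun p => bproj (C (tag p)) (tagged p) \o bproj B (tag p))).
- by move=> [i j] x /=; rewrite !binjK.
- move=> [i j] [i' j'] x /= pq; have [ii'|ii'] := eqVneq i i'; last first.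
    by rewrite bproj0 // linear0.
  subst i'; rewrite binjK bproj0 //; apply: contraNneq pq => ->; exact: eqxx.
- move=> x; rewrite -[RHS](bsum B).
  have E i : binj B i (bproj B i x) =
      \sum_j binj B i (binj (C i) j (bproj (C i) j (bproj B i x))).
    by rewrite -linear_sum bsum.
  by rewrite (eq_bigr _ (fun i _ => E i)) sig_big_dep.
Qed.

Lemma ker_biproduct M N (s : {linear N -> M}) (r : {linear M -> N})
    (I : finType) (X : I -> lmodType R) :
  cancel s r -> biproduct (ker r) X ->
  biproduct M (fun o : unit + I => if o is inr i then X i else N).
Proof.
move=> sK B.
have qP x : r ((idfun \- (s \o r)) x) = 0 by rewrite /= linearB sK subrr.
pose q : {linear M -> ker r} := ker_lift qP.
have qE x : ker_incl r (q x) = x - s (r x) by [].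
have qK : cancel (ker_incl r) q.
  by move=> u; apply: ker_incl_inj; rewrite qE ker_inclP linear0 subr0.
have qs x : q (s x) = 0 by apply: ker_incl_inj; rewrite qE sK subrr linear0.
pose Y := fun o : unit + I => if o is inr i then X i else N.
pose inj (o : unit + I) : {linear Y o -> M} :=
  match o with inr i => ker_incl r \o binj B i | inl _ => s end.
pose proj (o : unit + I) : {linear M -> Y o} :=
  match o with inr i => bproj B i \o q | inl _ => r end.
apply: (@Biproduct _ M _ Y inj proj) => [[[]|i] x|[[]|i] [[]|j] x ij|x] //.
- by rewrite -[LHS]/(bproj B i (q (ker_incl r (binj B i x)))) qK binjK.
- by rewrite -[LHS]/(bproj B j (q (s x))) qs linear0.
- exact: ker_inclP.
- by rewrite -[LHS]/(bproj B j (q (ker_incl r (binj B i x)))) qK bproj0.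
- have unit_sum : \sum_(i : unit) s (r x) = s (r x).
    by rewrite (bigD1 tt) //= big1 ?addr0 //; case.
  rewrite big_sumType; apply: etrans (congr1 (+%R^~ _) unit_sum) _.
  rewrite -(linear_sum (ker_incl r)) (bsum B) qE.
  by rewrite addrC subrK.
Qed.

Lemma retract_biproduct M (I : finType) (X : I -> lmodType R) i :
  inhabited (biproduct M X) -> retract (X i) M.
Proof. by case=> B; exists (binj B i), (bproj B i); exact: binjK. Qed.

Lemma finitely_generated_ker M N (s : {linear N -> M}) (r : {linear M -> N}) :
  cancel s r -> finitely_generated M -> finitely_generated (ker r).
Proof.
move=> sK; have qP x : r ((idfun \- (s \o r)) x) = 0 by rewrite /= linearB sK subrr.
apply: (finitely_generated_surj (f := ker_lift qP)) => u.
exists (ker_incl r u); apply: ker_incl_inj; rewrite ker_liftE /=.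
by rewrite ker_inclP linear0 subr0.
Qed.

Hypothesis krs : KRS R.

Lemma krs_decomposition M : finitely_generated M ->
  exists n (X : 'I_n -> lmodType R),
    (forall i, indecomposable (X i)) /\ inhabited (biproduct M X).
Proof.
move=> /krs[[n [X [Xi MX]]] _]; exists n, X; split=> //.
apply: biproduct_change MX _ (dsum_biproduct X) => i.
by exists idfun; exists id.
Qed.

Lemma krs_unique M (I J : finType) (X : I -> lmodType R) (Y : J -> lmodType R) i :
  finitely_generated M -> biproduct M X -> biproduct M Y ->
  (forall i, indecomposable (X i)) -> (forall j, indecomposable (Y j)) ->
  exists j, lmod_iso (X i) (Y j).
Proof.
move=> /krs[_ U] /biproduct_dsum MX /biproduct_dsum MY Xi Yi.
have [s [_ sE]] := U _ _ _ _ (fun i => Xi _) (fun j => Yi _) MX MY.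
have := sE (enum_rank i); rewrite enum_rankK.
by exists (enum_val (s (enum_rank i))).
Qed.

(** Besides X, the module N together with a decomposition of its complement in M
    decomposes M; uniqueness matches N with some X_i. *)
Lemma krs_retract N M (I : finType) (X : I -> lmodType R) :
  finitely_generated M -> indecomposable N -> retract N M ->
  biproduct M X -> (forall i, indecomposable (X i)) ->
  exists i, lmod_iso N (X i).
Proof.
move=> Mfg Ni [s [r sK]] MX Xi.
have [n [Z [Zi [KZ]]]] := krs_decomposition (finitely_generated_ker sK Mfg).
apply: (@krs_unique _ _ _ _ _ (inl tt) Mfg (ker_biproduct sK KZ) MX _ Xi).
by case.
Qed.

End Biproduct.

(** * Transfer of finite representation type *)

Definition preserves_biproducts (R S : pzRingType) (G : lmodType R -> lmodType S) :=
  forall M (I : finType) (X : I -> lmodType R),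
    biproduct M X -> inhabited (biproduct (G M) (fun i => G (X i))).

(** The target list consists of the indecomposable summands of the G(Z_k), where
    Z_1, ..., Z_p is the list for C. *)
Lemma finite_rep_type_transfer (R S : pzRingType) (G : lmodType R -> lmodType S)
    (C : lmodType R -> Prop) (D : lmodType S -> Prop) :
  KRS R -> KRS S ->
  (forall M, finitely_generated M -> finitely_generated (G M)) ->
  preserves_biproducts G ->
  (forall M, C M -> finitely_generated M) ->
  (forall M N, retract N M -> C M -> C N) ->
  (forall N, D N -> exists2 M, C M & retract N (G M)) ->
  finite_rep_type C -> finite_rep_type D.
Proof.
move=> krsR krsS Gfg Gbi Cfg Cret DC [p [Z Zrep]].
have decP k : exists dec : {n & 'I_n -> lmodType S},
    finitely_generated (G (Z k)) ->
    (forall l, indecomposable (projT2 dec l)) /\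
    inhabited (biproduct (G (Z k)) (projT2 dec)).
  have [fgZ|nfg] := pselect (finitely_generated (G (Z k))).
    by have [n [W WP]] := krs_decomposition krsS fgZ; exists (existT _ n W).
  (* Such a Z_k has no member of C isomorphic to it; it contributes nothing. *)
  by exists (existT _ 0%N (fun _ => G (Z k))).
have [dec {}decP] := choice decP.
pose T : finType := {k : 'I_p & 'I_(projT1 (dec k))}.
pose W (t : T) : lmodType S := projT2 (dec (tag t)) (tagged t).
exists #|T|, (fun i => W (enum_val i)) => N DN Ni.
suff [t Nt] : exists t, lmod_iso N (W t).
  by exists (enum_rank t); rewrite enum_rankK.
have [M CM NM] := DC N DN; have Mfg := Cfg M CM.
have [m [X [Xi MX]]] := krs_decomposition krsR Mfg.
have CX i : C (X i) by apply: Cret CM; exact: retract_biproduct.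
have [k kE] := choice (fun i => Zrep _ (CX i) (Xi i)).
have [MZ] : inhabited (biproduct M (fun i => Z (k i))).
  by apply: (@biproduct_change _ M M _ X _ _ kE MX); exists idfun; exists id.
have [GMZ] := Gbi _ _ _ MZ.
have GZfg i : finitely_generated (G (Z (k i))).
  apply: Gfg; apply: finitely_generated_retract Mfg.
  exact: (@retract_biproduct _ _ _ (fun i => Z (k i)) i (inhabits MZ)).
have GZbi i : {B : biproduct (G (Z (k i))) (projT2 (dec (k i))) | True}.
  by apply: cid; case: (decP (k i) (GZfg i)) => _ [B]; exists B.
have := biproduct_sigma GMZ (fun i => projT1 (GZbi i)).
move=> /(krs_retract krsS (Gfg _ Mfg) Ni NM)[|q Nq].
  by move=> [i l]; case: (decP (k i) (GZfg i)).
by exists (Tagged (fun k => 'I_(projT1 (dec k))) (tagged q)).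
Qed.

Section AlongMorphism.
Variables (R A : pzRingType) (phi : {rmorphism R -> A}).

Lemma restr_biproducts : preserves_biproducts (fun N => restr phi N).
Proof.
move=> M I X B; constructor.
apply: (@Biproduct _ _ _ _ (fun i => restr_map phi (binj B i))
  (fun i => restr_map phi (bproj B i))) => [i x|i j x|x].
- exact: (@binjK _ _ _ _ B).
- exact: (@bproj0 _ _ _ _ B).
- exact: (@bsum _ _ _ _ B).
Qed.

Lemma coind_biproducts : preserves_biproducts (fun M => coind phi M).
Proof.
move=> M I X B; constructor.
apply: (@Biproduct _ _ _ _ (fun i => coind_map phi (binj B i))
  (fun i => coind_map phi (bproj B i))) => [i f|i j f ij|f].
- by apply: hom_ext => a; rewrite !coind_mapE binjK.
- by apply: hom_ext => a; rewrite !coind_mapE bproj0.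
- by apply: hom_ext => a; rewrite coind_sumE; exact: bsum.
Qed.

(** The image e of 1 under a bimodule section of the multiplication satisfies
    a e = e a; this equation in the tensor product is recorded through its
    consequences for balanced maps b. *)
Lemma separability_element : separable phi ->
  exists s : seq (A * A), \sum_(p <- s) p.1 * p.2 = 1 /\
    forall (V : zmodType) (b : A -> A -> V),
      (forall x x' y, b (x + x') y = b x y + b x' y) ->
      (forall x y y', b x (y + y') = b x y + b x y') ->
      (forall x r y, b (x * phi r) y = b x (phi r * y)) ->
      forall a, \sum_(p <- s) b (a * p.1) p.2 = \sum_(p <- s) b p.1 (p.2 * a).
Proof.
case=> sec [secR secK]; pose e := sec (1 : A).
exists (tensor_repr e); split.
  rewrite -[RHS]secK -/e -{2}[e]tensor_reprK.
  by rewrite /ext_mul tensor_lift_pi //= => *; rewrite ?mulrDl ?mulrDr ?mulrA.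
move=> V b bDl bDr bZ a.
have ae : a *: e = ract e a.
  rewrite -secR -linearZ; congr (sec _).
  by rewrite -[LHS]/(a * 1) -[RHS]/(1 * a) mulr1 mul1r.
have L (s : seq (A * A)) : @tensor_lift _ _ (ext_AR phi) (ext_RA phi) V b
    (@tensor_pi _ _ (ext_AR phi) (ext_RA phi) s) =
    \sum_(p <- s) b p.1 p.2 by exact: tensor_lift_pi.
have := congr1 (@tensor_lift _ _ (ext_AR phi) (ext_RA phi) V b) ae.
rewrite -{1 2}[e]tensor_reprK.
rewrite -[ract _ a]/(tensor_ract _ a) tensor_ract_pi.
rewrite -[a *: _]/(tensor_scale a _) tensor_scale_pi !L !big_map.
by [].
Qed.

(** The map sending n to (a |-> a n) is split by f |-> sum s_i f(t_i), where
    the sum of the tensors of s_i and t_i is the separability element, and its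
    commuting with A is what makes the splitting A-linear. *)
Lemma separable_retract (N : lmodType A) :
  separable phi -> retract N (coind phi (restr phi N)).
Proof.
move=> /separability_element[s [s1 sP]].
have r_lin : linear (fun f : coind phi (restr phi N) =>
    \sum_(p <- s) p.1 *: (f p.2 : N)).
  move=> a f g; rewrite scaler_sumr.
  under eq_bigr => p _ do rewrite coindD coindZ scalerDr.
  rewrite big_split; congr (_ + _).
  rewrite -(sP N (fun x y => x *: (f y : N))) => [|x x' y|x y y'|x r y].
  - by apply: eq_bigr => p _; rewrite scalerA.
  - exact: scalerDl.
  - by rewrite linearD scalerDr.
  - by rewrite coind_restrZ -scalerA.
exists (coind_adjunct (idfun : {linear restr phi N -> restr phi N})).
exists (mk_linear r_lin) => n /=.
by under eq_bigr => p _ do rewrite scalerA; rewrite -scaler_suml s1 scale1r.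
Qed.

(** Let rho : A -> R be the bimodule projection and c the element of A
    corresponding to 1 in R.  The map sending m to (a |-> rho(a) m) is split by
    evaluation at c, which is R-linear because c commutes with R. *)
Lemma split_retract (M : lmodType R) :
  split_extension phi -> retract M (restr phi (coind phi M)).
Proof.
case=> B [f [fR /[dup] fB /bij_surj fS]].
have [c cE] := fS (1, 0).
have fl r (a : A) : (f (phi r * a : A)).1 = r * (f a).1.
  have -> : f (phi r * a : A) = r *: f a by rewrite -linearZ.
  by [].
have cC r : phi r * (c : A) = (c : A) * phi r.
  apply: (bij_inj fB); transitivity (r *: f c); first by rewrite -linearZ.
  have -> : f ((c : A) * phi r : A) = ract (f c) r by rewrite -fR.
  rewrite cE; congr (_, _).
    by rewrite -[LHS]/(r * 1) mulr1 -[RHS]/(1 * r) mul1r.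
  rewrite /= scaler0; apply: (addrI (ract (0 : B) r)).
  by rewrite -ractDl !addr0.
have fD (a b : A) : (f (a + b)).1 = (f a).1 + (f b).1 by rewrite linearD.
have fr r (a : A) : (f (a * phi r : A)).1 = ((f a).1 : R) * r.
  by have -> : f (a * phi r : A) = ract (f a) r by rewrite -fR.
have s_lin1 m : linear ((fun a : A => ((f a).1 : R) *: m) : restr phi A^o -> M).
  move=> r a b; rewrite -[r *: a]/(phi r * (a : A)) fD fl.
  by rewrite scalerDl scalerA.
have s_lin2 :
    linear (fun m => mk_linear (s_lin1 m) : restr phi (coind phi M)).
  move=> r m m'; apply: hom_ext => a /=; rewrite scalerDr scalerA -fr.
  by [].
have r_lin : linear (fun F : restr phi (coind phi M) => (F : coind phi M) (c : A)).
  move=> r F F'; rewrite -[r *: F]/(phi r *: (F : coind phi M)).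
  by rewrite coindD coindZ -cC coind_restrZ.
exists (mk_linear s_lin2), (mk_linear r_lin) => m /=.
by rewrite cE scale1r.
Qed.

End AlongMorphism.

Theorem proposition6p6 (R A : pzRingType) (phi : {rmorphism R -> A}) (n : nat)
    (n_gt0 : (0 < n)%N)
    (noethR : noetherian R)
    (frob : frobenius phi)
    (krsR : KRS R)
    (krsA : KRS A) :
  (separable phi ->
     finite_rep_type (@TF R n) -> finite_rep_type (@TF A n)) /\
  (split_extension phi ->
     finite_rep_type (@TF A n) -> finite_rep_type (@TF R n)).
Proof.
have [E] := frobenius_system_exists frob; split=> ext.
- apply: (finite_rep_type_transfer (G := fun M => coind phi M)) => //.
  + exact: (coind_fg E).
  + exact: coind_biproducts.
  + by move=> M [].
  + by move=> M N; exact: TF_retract.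
  + move=> N NTF; exists (restr phi N); first exact: TF_restr NTF.
    exact: separable_retract.
- apply: (finite_rep_type_transfer (G := fun N => restr phi N)) => //.
  + exact: (restr_fg E).
  + exact: restr_biproducts.
  + by move=> M [].
  + by move=> M N; exact: TF_retract.
  + move=> M MTF; exists (coind phi M); first exact: TF_coind MTF.
    exact: split_retract.
Qed.
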